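(* Let $\mathcal H=(\mathcal H_L,\mathcal H_R,S)$ be a pure Hopf algebroid and $A$ a right $\mathcal H_R$-comodule algebra. Let $\mathcal C$ be the associated $A$-coring $A\otimes_RH$, with coproduct inherited from $\mathcal H_R$. Then $A$ is an $\mathcal H$-cleft extension of its $\mathcal H_R$-coinvariant subalgebra if and only if the following hold. (a) $A$ is an $L$-ring. (b) $A$ (with the left $L$-module structure in (a), the right regular $A$-module structure and the given $\mathcal H_R$-comodule structure) is a cleft $L$-$\mathcal C$ bicomodule for the coring extension $\mathcal H_L$ of $\mathcal C$.
   Context: Fix a commutative ring $k$; algebras are associative unital $k$-algebras. An $R$-ring is an algebra $A$ with an algebra map $\eta_R:R\to A$; an $R$-coring is a comonoid in $R$-bimodules. Bialgebroids. A left $L$-bialgebroid $\mathcal H_L=(H,L,s_L,t_L,\gamma_L,\pi_L)$ consists of algebras $H,L$, algebra maps $s_L:L\to H$, $t_L:L^{op}\to H$ with commuting ranges, and an $L$-coring structure $(\gamma_L,\pi_L)$ on $H$ with $L$-bimodule structure $l\cdot h\cdot l'=s_L(l)t_L(l')h$, $\gamma_L(h)=h_{(1)}\otimes_Lh_{(2)}$, such that $h_{(1)}t_L(l)\otimes_Lh_{(2)}=h_{(1)}\otimes_Lh_{(2)}s_L(l)$, $\gamma_L$ is unital and multiplicative, $\pi_L(1_H)=1_L$ and $\pi_L(hs_L(\pi_L(h')))=\pi_L(hh')=\pi_L(ht_L(\pi_L(h')))$. A right $R$-bialgebroid $\mathcal H_R=(H,R,s_R,t_R,\gamma_R,\pi_R)$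 consists of algebras $H,R$, algebra maps $s_R:R\to H$, $t_R:R^{op}\to H$ with commuting ranges, and an $R$-coring structure $(\gamma_R,\pi_R)$ on $H$ with $R$-bimodule structure $r\cdot h\cdot r'=hs_R(r')t_R(r)$, $\gamma_R(h)=h^{(1)}\otimes_Rh^{(2)}$, such that $s_R(r)h^{(1)}\otimes_Rh^{(2)}=h^{(1)}\otimes_Rt_R(r)h^{(2)}$, $\gamma_R$ is unital and multiplicative, $\pi_R(1_H)=1_R$ and $\pi_R(s_R(\pi_R(h))h')=\pi_R(hh')=\pi_R(t_R(\pi_R(h))h')$. Hopf algebroid. $\mathcal H=(\mathcal H_L,\mathcal H_R,S)$ consists of a left $L$-bialgebroid and a right $R$-bialgebroid on the same total algebra $H$, and a $k$-linear map $S:H\to H$ such that: $s_L\pi_Lt_R=t_R$, $t_L\pi_Ls_R=s_R$, $s_R\pi_Rt_L=t_L$, $t_R\pi_Rs_L=s_L$; $(\gamma_L\otimes_RH)\gamma_R=(H\otimes_L\gamma_R)\gamma_L$ and $(\gamma_R\otimes_LH)\gamma_L=(H\otimes_R\gamma_L)\gamma_R$; $S(t_L(l)ht_R(r))=s_R(r)S(h)s_L(l)$; $S(h_{(1)})h_{(2)}=s_R(\pi_R(h))$ and $h^{(1)}S(h^{(2)})=s_L(\pi_L(h))$. Pure coring extensions. For an $A$-coring $\mathcal C$ (coproduct $c\mapsto c^{(1)}\otimes_Ac^{(2)}$, counit $\epsilon_{\mathcal C}$, right coactions $m\mapsto m^{[0]}\otimes_Am^{[1]}$) and an $L$-coring $\mathcal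 D$ (coproduct $d\mapsto d_{(1)}\otimes_Ld_{(2)}$), $\mathcal D$ is a right extension of $\mathcal C$ if $\mathcal C$ is a $\mathcal C$-$\mathcal D$ bicomodule with left coaction $\Delta_{\mathcal C}$ and some right $\mathcal D$-coaction $c\mapsto c_{[0]}\otimes_Lc_{[1]}$. Every right $\mathcal C$-comodule $M$ is a right $L$-module via $ml=m^{[0]}\epsilon_{\mathcal C}(m^{[1]}l)$, and the extension is pure if for every right $\mathcal C$-comodule $(M,\varrho)$ the equalizer $M\xrightarrow{\varrho}M\otimes_A\mathcal C\rightrightarrows M\otimes_A\mathcal C\otimes_A\mathcal C$ of $\varrho\otimes_A\mathcal C$ and $M\otimes_A\Delta_{\mathcal C}$ in $\mathcal M_L$ is preserved by $-\otimes_L\mathcal D\otimes_L\mathcal D$. Then any right $\mathcal C$-comodule $M$ is a right $\mathcal D$-comodule via $m\mapsto m^{[0]}\epsilon_{\mathcal C}({m^{[1]}}_{[0]})\otimes_L{m^{[1]}}_{[1]}$. In a Hopf algebroid, the coring $(H,\gamma_L,\pi_L)$ is a right extension of $(H,\gamma_R,\pi_R)$ (via $\gamma_L$) and vice versa (via $\gamma_R$); $\mathcal H$ is called pure if both extensions are pure. For pure $\mathcal H$, right $\mathcal H_R$-comodules and right $\mathcal H_L$-comodules are thereby identified. Comodule algebras. A right $\mathcal H_R$-comodule is a right comodule of the $R$-coring $(H,\gamma_R,\pi_R)$, coaction $m\mapsto m^{[0]}\otimes_Rm^{[1]}$; it is an $R$-bimodule with left action $r\cdot m=m^{[0]}\pi_R(s_R(r)m^{[1]})$,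 and these comodules form a monoidal category via $\otimes_R$ and the diagonal coaction. A right $\mathcal H_R$-comodule algebra is a monoid $A$ in it, i.e. an $R$-ring $(A,\eta_R)$ with a right $\mathcal H_R$-coaction (whose $R$-bimodule structure is the one from $\eta_R$) such that $(aa')^{[0]}\otimes_R(aa')^{[1]}=a^{[0]}a'^{[0]}\otimes_Ra^{[1]}a'^{[1]}$ and $1_A\mapsto1_A\otimes_R1_H$. The $\mathcal H_R$-coinvariant subalgebra is $T=\{t\in A\mid t^{[0]}\otimes_Rt^{[1]}=t\otimes_R1_H\}$. The associated $A$-coring is $\mathcal C=A\otimes_RH$ with $b(a\otimes_Rh)a'=baa'^{[0]}\otimes_Rha'^{[1]}$, coproduct $A\otimes_R\gamma_R$, counit $A\otimes_R\pi_R$. For pure $\mathcal H$ the $L$-coring $(H,\gamma_L,\pi_L)$ is a pure right extension of $\mathcal C$ via $A\otimes_R\gamma_L$. The $\mathcal H_R$-coaction makes the right regular $A$-module $A$ a right $\mathcal C$-comodule. $\mathcal H$-cleft extension. $A$ is an $\mathcal H$-cleft extension of $T$ if (i) $A$ is an $L$-ring, with unit map $\eta_L:L\to A$, and $T$ is an $L$-subring of $A$; (ii) there is a left $L$-linear right $\mathcal H_R$-colinear map $\lambda:H\to A$ ($\lambda(s_L(l)h)=\eta_L(l)\lambda(h)$) and a left $R$-linear right $L$-linear map $\bar\lambda:H\to A$ ($\bar\lambda(ht_R(r))=\eta_R(r)\bar\lambda(h)$, $\bar\lambda(t_L(l)h)=\bar\lambda(h)\eta_L(l)$) with $\lambda(h^{(1)})\bar\lambda(h^{(2)})=\eta_L(\pi_L(h))$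 and $\bar\lambda(h_{(1)})\lambda(h_{(2)})=\eta_R(\pi_R(h))$ for all $h\in H$. Cleft bicomodules. For a pure right extension $(\mathcal D:L)$ of $(\mathcal C:A)$, an $L$-$\mathcal C$ bicomodule is a left $L$-module and right $\mathcal C$-comodule $\Sigma$ (an $L$-$A$ bimodule) with left $L$-linear $\mathcal C$-coaction. $T_\Sigma=\mathrm{End}^{\mathcal C}(\Sigma)$ is an $L$-ring via $l\mapsto(x\mapsto lx)$, $\Sigma^*=\mathrm{Hom}_A(\Sigma,A)$ is an $A$-$L$ bimodule via $(a\xi l)(x)=a\xi(lx)$, and $$\widetilde Q=\{q\in{}_A\mathrm{Hom}_L(\mathcal C,\Sigma^* )\mid c^{(1)}q(c^{(2)})(x)=q(c)(x^{[0]})x^{[1]}\ \forall x\in\Sigma,c\in\mathcal C\}.$$ For left $L$-linear right $\mathcal D$-colinear $p:\mathcal D\to\Sigma$ and $q\in\widetilde Q$ put $(q\bullet p)(c)=q(c_{[0]})\big(p(c_{[1]})^{[0]}\big)p(c_{[1]})^{[1]}$ and $(p\lozenge q)(d)=p(d)^{[0]}q(p(d)^{[1]})(-)\in T_\Sigma$. $\Sigma$ is cleft if there exist a left $L$-linear right $\mathcal D$-colinear $j:\mathcal D\to\Sigma$ and $\tilde\jmath\in\widetilde Q$ with $\tilde\jmath\bullet j=\mathrm{id}_{\mathcal C}$ and $j\lozenge\tilde\jmath=\epsilon_{\mathcal D}(-)1_{T_\Sigma}$. *)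

(* Defs.v *)
From HB Require Import structures.
From mathcomp Require Import all_boot all_order all_algebra.
From mathcomp Require Import boolp.

Set Implicit Arguments.
Unset Strict Implicit.
Unset Printing Implicit Defensive.

Import GRing.Theory.
Local Open Scope ring_scope.
Local Open Scope quotient_scope.

(* An associative unital k-algebra is a ring with a central ring morphism
   c |-> c 1 from k. Unlike in [algType k], the zero ring is allowed. *)
Record kalgebra (k : comPzRingType) := KAlgebra {
  kring :> pzRingType;
  kunit : {rmorphism k -> kring};
  kunit_central : forall c x, kunit c * x = x * kunit c
}.

Arguments kunit {k _}.

Definition additive_map (M N : zmodType) (f : M -> N) :=
  {morph f : x y / x + y}.

Section AlgebraMaps.
Variables (k : comPzRingType) (A B : kalgebra k) (f : A -> B).

Definition k_linear :=
  additive_map f /\ forall c x, f (kunit c * x) = kunit c * f x.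

Definition algebra_map := k_linear /\ monoid_morphism f.

(* f is an algebra map from the opposite algebra of A to B *)
Definition anti_algebra_map :=
  [/\ k_linear, f 1 = 1 & forall x y, f (x * y) = f y * f x].

End AlgebraMaps.

(** * Tensor products

  One abelian group carries several actions of several rings in what follows,
  so actions are explicit functions rather than canonical structures.
  [tens ra la] is the tensor product of M (with right action [ra]) and N (with
  left action [la]).  Since - (x \ot y) = (- x) \ot y, every tensor is a sum of
  pure ones: a tensor is a class of lists of pairs, two lists being identified
  when no balanced biadditive map distinguishes them. *)

Section Tensor.
Variables (R : Type) (M N : zmodType) (ra : M -> R -> M) (la : R -> N -> N).

Definition balanced (Z : zmodType) (f : M -> N -> Z) :=
  [/\ forall y, additive_map (f^~ y), forall x, additive_map (f x)
    & forall x r y, f (ra x r) y = f x (la r y)].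

Definition list_eval (Z : zmodType) (f : M -> N -> Z) (s : seq (M * N)) :=
  \sum_(p <- s) f p.1 p.2.

Definition tens_eq (s t : seq (M * N)) : bool :=
  `[< forall (Z : zmodType) (f : M -> N -> Z),
        balanced f -> list_eval f s = list_eval f t >].

Lemma tens_eq_equiv : equiv_class_of tens_eq.
Proof.
split.
- by move=> s; apply/asboolP.
- by move=> s t; apply/asboolP/asboolP => st Z f bf; rewrite st.
- by move=> t s u /asboolP st /asboolP tu; apply/asboolP => Z f bf;
    rewrite st ?tu.
Qed.

Canonical tens_equiv := EquivRelPack tens_eq_equiv.

Definition tens := {eq_quot tens_equiv}.

HB.instance Definition _ := Choice.on tens.
HB.instance Definition _ := Quotient.on tens.

Definition tpure (x : M) (y : N) : tens := \pi_tens [:: (x, y)].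

(* The value at t of the group morphism induced by f. If f is not balanced this
   depends on the representative of t chosen by the library. *)
Definition tlift (Z : zmodType) (f : M -> N -> Z) (t : tens) : Z :=
  list_eval f (repr t).

Definition tadd (t u : tens) : tens := \pi_tens (repr t ++ repr u).
Definition topp (t : tens) : tens :=
  \pi_tens [seq (- p.1, p.2) | p <- repr t].

Lemma balanced0l (Z : zmodType) (f : M -> N -> Z) y : balanced f -> f 0 y = 0.
Proof.
by case=> /(_ y 0 0) /= fD _ _; apply: (addrI (f 0 y)); rewrite -fD !addr0.
Qed.

Lemma balancedNl (Z : zmodType) (f : M -> N -> Z) x y :
  balanced f -> f (- x) y = - f x y.
Proof.
move=> bf; apply: (addrI (f x y)); rewrite subrr -[RHS](balanced0l y bf).
by case: bf => /(_ y x (- x)) /= <- _ _; rewrite subrr.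
Qed.

Lemma list_eval_repr (Z : zmodType) (f : M -> N -> Z) s : balanced f ->
  list_eval f (repr (\pi_tens s)) = list_eval f s.
Proof.
by move=> bf; have /eqmodP/asboolP := reprK (\pi_tens s); apply.
Qed.

Lemma tens_eqP (t u : tens) : (forall (Z : zmodType) (f : M -> N -> Z), balanced f ->
  tlift f t = tlift f u) -> t = u.
Proof.
move=> tu; rewrite -[t]reprK -[u]reprK; apply/eqmodP/asboolP => Z f bf.
exact: tu.
Qed.

Lemma tlift_pure (Z : zmodType) (f : M -> N -> Z) x y : balanced f ->
  tlift f (tpure x y) = f x y.
Proof.
by move=> bf; rewrite /tlift list_eval_repr // /list_eval big_seq1.
Qed.

Lemma tlift_tadd (Z : zmodType) (f : M -> N -> Z) t u : balanced f ->
  tlift f (tadd t u) = tlift f t + tlift f u.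
Proof.
by move=> bf; rewrite /tlift /tadd list_eval_repr // /list_eval big_cat.
Qed.

Lemma tlift_topp (Z : zmodType) (f : M -> N -> Z) t : balanced f ->
  tlift f (topp t) = - tlift f t.
Proof.
move=> bf; rewrite /tlift /topp list_eval_repr // /list_eval big_map -sumrN.
by apply: eq_bigr => p _ /=; rewrite balancedNl.
Qed.

Lemma tlift_nil (Z : zmodType) (f : M -> N -> Z) : balanced f ->
  tlift f (\pi_tens [::]) = 0.
Proof. by move=> bf; rewrite /tlift list_eval_repr // /list_eval big_nil. Qed.

Lemma taddA : associative tadd.
Proof.
by move=> t u v; apply: tens_eqP => Z f bf; rewrite !tlift_tadd // addrA.
Qed.

Lemma taddC : commutative tadd.
Proof.
by move=> t u; apply: tens_eqP => Z f bf; rewrite !tlift_tadd // addrC.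
Qed.

Lemma tadd0 : left_id (\pi_tens [::]) tadd.
Proof.
move=> t; apply: tens_eqP => Z f bf.
by rewrite !tlift_tadd // tlift_nil // add0r.
Qed.

Lemma taddN : left_inverse (\pi_tens [::]) topp tadd.
Proof.
move=> t; apply: tens_eqP => Z f bf.
by rewrite !tlift_tadd // tlift_topp // addNr tlift_nil.
Qed.

HB.instance Definition _ := GRing.isZmodule.Build tens taddA taddC tadd0 taddN.

Lemma tliftD (Z : zmodType) (f : M -> N -> Z) : balanced f -> additive_map (tlift f).
Proof. by move=> bf t u; exact: tlift_tadd. Qed.

Lemma tpure_balanced : balanced (tpure : M -> N -> tens).
Proof.
split=> [y x x' | x y y' | x r y] /=; apply: tens_eqP => Z f bf;
  rewrite ?tliftD // !tlift_pure //; case: bf => fl fr fm;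
  [exact: fl | exact: fr | exact: fm].
Qed.

Lemma tens_ind (P : tens -> Prop) :
  P 0 -> (forall x y t, P t -> P (tpure x y + t)) -> forall t, P t.
Proof.
move=> P0 PD t; rewrite -[t]reprK; elim: (repr t) => [|[x y] s IH] //.
suff -> : \pi_tens ((x, y) :: s) = tpure x y + \pi_tens s by exact: PD.
apply: tens_eqP => Z f bf; rewrite tliftD // tlift_pure //.
by rewrite /tlift !list_eval_repr // /list_eval big_cons.
Qed.

End Tensor.

Arguments tpure {R M N ra la} x y.
Arguments tlift {R M N ra la Z} f t.

Notation "x \ot y" := (tpure x y)
  (at level 40, left associativity) : ring_scope.

(* Sweedler notation: the image of t under x \ot y |-> E. *)
Notation "\tsum_ ( x , y <- t ) E" := (tlift (fun x y => E) t)
  (at level 41, E at level 41, x name, y name, t at level 50,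
   format "\tsum_ ( x ,  y  <-  t )  E") : ring_scope.

(* f \ot g *)
Definition tmap (R : Type) (M N M' N' : zmodType)
    (ra : M -> R -> M) (la : R -> N -> N)
    (ra' : M' -> R -> M') (la' : R -> N' -> N')
    (f : M -> M') (g : N -> N') (t : tens ra la) : tens ra' la' :=
  \tsum_(x, y <- t) f x \ot g y.

Arguments tmap {R M N M' N' ra la ra' la'} f g t.

Section TensorActions.
Variables (R S : Type) (M N : zmodType) (ra : M -> R -> M) (la : R -> N -> N).

Definition tact_left (ls : S -> M -> M) (s : S) (t : tens ra la) : tens ra la :=
  tmap (ls s) id t.

Definition tact_right (rs : N -> S -> N) (t : tens ra la) (s : S) :
  tens ra la := tmap id (rs^~ s) t.

End TensorActions.

Arguments tact_left {R S M N ra la} ls s t.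
Arguments tact_right {R S M N ra la} rs t s.

(** * Modules, corings, comodules *)

Definition is_lmodule (A : pzRingType) (M : zmodType) (la : A -> M -> M) :=
  [/\ forall a, additive_map (la a), forall x, additive_map (la^~ x),
      forall x, la 1 x = x & forall a b x, la (a * b) x = la a (la b x)].

Definition is_rmodule (A : pzRingType) (M : zmodType) (ra : M -> A -> M) :=
  [/\ forall a, additive_map (ra^~ a), forall x, additive_map (ra x),
      forall x, ra x 1 = x & forall x a b, ra x (a * b) = ra (ra x a) b].

(* The two actions of k on a bimodule over k-algebras agree. *)
Definition is_bimodule (k : comPzRingType) (A B : kalgebra k) (M : zmodType)
    (la : A -> M -> M) (rb : M -> B -> M) :=
  [/\ is_lmodule la, is_rmodule rb,
      forall a x b, la a (rb x b) = rb (la a x) b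
    & forall (c : k) x, la (kunit c) x = rb x (kunit c)].

Record coring_data (A : pzRingType) := CoringData {
  ccar :> zmodType;
  cleft_act : A -> ccar -> ccar;
  cright_act : ccar -> A -> ccar;
  copr : ccar -> tens cright_act cleft_act;
  counit : ccar -> A
}.

Arguments cleft_act {A c}.
Arguments cright_act {A c}.
Arguments copr {A c}.
Arguments counit {A c}.

Record is_comodule (A : pzRingType) (C : coring_data A) (M : zmodType)
    (ra : M -> A -> M) (rho : M -> tens ra (@cleft_act A C)) : Prop := {
  comod_rmodule : is_rmodule ra;
  comod_additive : additive_map rho;
  comod_linear : forall m a, rho (ra m a) = tact_right cright_act (rho m) a;
  comod_coassoc : forall m,
    \tsum_(m0, m1 <- rho m) (rho m0 \ot m1)
    = \tsum_(m0, m1 <- rho m) \tsum_(c1, c2 <- copr m1) (m0 \ot c1) \ot c2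
    :> tens (tact_right (@cright_act A C)) cleft_act;
  comod_counit : forall m, \tsum_(m0, m1 <- rho m) ra m0 (counit m1) = m
}.

Record is_coring (k : comPzRingType) (A : kalgebra k) (C : coring_data A) :
    Prop := {
  coring_bimodule : is_bimodule (@cleft_act A C) (@cright_act A C);
  copr_left_linear : forall a (c : C),
    copr (cleft_act a c) = tact_left cleft_act a (copr c);
  counit_additive : additive_map (@counit A C);
  counit_left_linear : forall a (c : C), counit (cleft_act a c) = a * counit c;
  counit_right_linear : forall (c : C) a,
    counit (cright_act c a) = counit c * a;
  (* right linearity and coassociativity of the coproduct, and one counit law *)
  copr_comodule : is_comodule (@copr A C);
  copr_counit_left : forall c : C,
    \tsum_(c1, c2 <- copr c) cleft_act (counit c1) c2 = c
}.

Definition colinear (A : pzRingType) (C : coring_data A) (M N : zmodType)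
    (ra : M -> A -> M) (rho : M -> tens ra (@cleft_act A C))
    (ra' : N -> A -> N) (rho' : N -> tens ra' (@cleft_act A C))
    (f : M -> N) :=
  [/\ additive_map f, forall m a, f (ra m a) = ra' (f m) a
    & forall m, rho' (f m) = tmap f id (rho m)].

(** * Coring extensions *)

Record extension_data (A L : pzRingType) (C : coring_data A)
    (D : coring_data L) := ExtensionData {
  ext_act : C -> L -> C;
  ext_coact : C -> tens ext_act (@cleft_act L D)
}.

Section Extensions.
Variables (k : comPzRingType) (A L : kalgebra k).
Variables (C : coring_data A) (D : coring_data L) (E : extension_data C D).

(* C is a C-D bicomodule with left coaction the coproduct of C. *)
Record is_right_extension : Prop := {
  ext_bimodule : is_bimodule (@cleft_act A C) (@ext_act _ _ _ _ E);
  ext_comodule : is_comodule (@ext_coact _ _ _ _ E);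
  ext_coact_left_linear : forall a (c : C),
    ext_coact E (cleft_act a c) = tact_left cleft_act a (ext_coact E c);
  ext_copr_right_linear : forall (c : C) l,
    copr (ext_act E c l) = tact_right (ext_act E) (copr c) l;
  ext_bicomodule : forall c : C,
    \tsum_(c0, d <- ext_coact E c) (copr c0 \ot d)
    = \tsum_(c1, c2 <- copr c)
        \tsum_(c20, d <- ext_coact E c2) (c1 \ot c20) \ot d
    :> tens (tact_right (ext_act E)) cleft_act
}.

Section InducedStructures.
Variables (M : zmodType) (ra : M -> A -> M).
Variable rho : M -> tens ra (@cleft_act A C).

Definition ind_act (m : M) (l : L) : M :=
  \tsum_(m0, m1 <- rho m) ra m0 (counit (ext_act E m1 l)).

(* The D-coaction m |-> m0 eps(m1_[0]) \ot_L m1_[1]. The map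
   m \ot_A c |-> m eps(c) is not right L-linear on all of M \ot_A C, but it
   inverts rho on the equalizer rho(M). Hence the formula denotes the element t
   of M \ot_L D such that (rho \ot_L D)(t) = m0 \ot_A m1_[0] \ot_L m1_[1],
   which exists and is unique for a pure extension. *)
Definition is_ind_coact (m : M) (t : tens ind_act (@cleft_act L D)) :=
  tmap rho id t
  = \tsum_(m0, m1 <- rho m) \tsum_(c, d <- ext_coact E m1) (m0 \ot c) \ot d
  :> tens (tact_right (ext_act E)) cleft_act.

Definition ind_coact (m : M) : tens ind_act (@cleft_act L D) :=
  if pselect (exists t, is_ind_coact m t) is left ex then sval (cid ex) else 0.

End InducedStructures.

(* X \ot_L D \ot_L D for a right L-module X *)
Definition tensDD (X : zmodType) (rx : X -> L -> X) : zmodType :=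
  tens (tact_right (la := @cleft_act L D) (ra := rx) cright_act)
       (@cleft_act L D).

Definition tensDD_map (X Y : zmodType) (rx : X -> L -> X) (ry : Y -> L -> Y)
    (f : X -> Y) : tensDD rx -> tensDD ry :=
  tmap (tmap f id) id.

Arguments tensDD_map {X Y} rx ry f t.

Definition is_equalizer (X Y Z : Type) (e : X -> Y) (f g : Y -> Z) :=
  injective e /\ forall y, f y = g y <-> exists x, e x = y.

(* For every right C-comodule M, the equalizer of rho \ot_A C and
   M \ot_A copr given by rho is preserved by - \ot_L D \ot_L D. *)
Definition preserves_comodule_equalizers :=
  forall (M : zmodType) (ra : M -> A -> M)
      (rho : M -> tens ra (@cleft_act A C)),
    is_comodule rho ->
    let rMC := tact_right (ext_act E) : tens ra cleft_act -> L -> _ in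
    let rMCC := tact_right (ext_act E) :
      tens (tact_right (ra := ra) cright_act) cleft_act -> L -> _ in
    is_equalizer
      (tensDD_map (ind_act rho) rMC rho)
      (tensDD_map rMC rMCC (fun t => \tsum_(m, c <- t) (rho m \ot c)))
      (tensDD_map rMC rMCC
        (fun t => \tsum_(m, c <- t) \tsum_(c1, c2 <- copr c)
                    (m \ot c1) \ot c2)).

Definition pure_right_extension :=
  is_right_extension /\ preserves_comodule_equalizers.

(** * Cleft bicomodules *)

Section CleftBicomodule.
Variables (X : zmodType) (lx : L -> X -> X) (rx : X -> A -> X).
Variable rho : X -> tens rx (@cleft_act A C).

Definition is_bicomodule :=
  [/\ is_bimodule lx rx, is_comodule rho
    & forall l x, rho (lx l x) = tact_left lx l (rho x)].

Definition is_left_linear_colinear (p : D -> X) :=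
  (forall l d, p (cleft_act l d) = lx l (p d))
  /\ colinear (@copr L D) (ind_coact rho) p.

(* q belongs to Q~ , where q c x is the value at x of q(c) in Hom_A(X, A) *)
Record in_Qtilde (q : C -> X -> A) : Prop := {
  Q_dual_additive : forall c, additive_map (q c);
  Q_dual_linear : forall c x a, q c (rx x a) = q c x * a;
  Q_additive : forall x, additive_map (q^~ x);
  Q_left_linear : forall a c x, q (cleft_act a c) x = a * q c x;
  Q_right_linear : forall c l x, q (ext_act E c l) x = q c (lx l x);
  Q_coring : forall x (c : C),
    \tsum_(c1, c2 <- copr c) cright_act c1 (q c2 x)
    = \tsum_(x0, x1 <- rho x) cleft_act (q c x0) x1
}.

(* q . p *)
Definition bullet (q : C -> X -> A) (p : D -> X) (c : C) : C :=
  \tsum_(c0, d <- ext_coact E c) \tsum_(x0, x1 <- rho (p d))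
    cleft_act (q c0 x0) x1.

(* p <> q ; its values are endomorphisms of X *)
Definition lozenge (p : D -> X) (q : C -> X -> A) (d : D) (x : X) : X :=
  \tsum_(x0, x1 <- rho (p d)) rx x0 (q x1 x).

Definition cleft_bicomodule :=
  is_bicomodule /\
  exists (j : D -> X) (jt : C -> X -> A),
    [/\ is_left_linear_colinear j, in_Qtilde jt,
        forall c, bullet jt j c = c
      & forall d x, lozenge j jt d x = lx (counit d) x].

End CleftBicomodule.

End Extensions.

(** * Bialgebroids and Hopf algebroids *)

Section HopfAlgebroids.
Variable k : comPzRingType.

Record left_bialgebroid (H L : kalgebra k) := LeftBialgebroid {
  sL : L -> H;
  tL : L -> H;
  gammaL : H -> tens (fun h l => tL l * h) (fun l h => sL l * h);
  piL : H -> L;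
  left_coring := CoringData gammaL piL;
  sL_map : algebra_map sL;
  tL_map : anti_algebra_map tL;
  sL_tL_comm : forall l l', sL l * tL l' = tL l' * sL l;
  left_coringP : is_coring left_coring;
  gammaL_takeuchi : forall l h,
    \tsum_(h1, h2 <- gammaL h) ((h1 * tL l) \ot h2)
    = \tsum_(h1, h2 <- gammaL h) (h1 \ot (h2 * sL l))
    :> tens (fun h l => tL l * h) (fun l h => sL l * h);
  gammaL1 : gammaL 1 = 1 \ot 1;
  (* The order of summation matters: the inner sum is balanced as it stands,
     and then gammaL_takeuchi makes the outer one balanced. *)
  gammaLM : forall h h',
    gammaL (h * h') =
      \tsum_(h'1, h'2 <- gammaL h') \tsum_(h1, h2 <- gammaL h)
        ((h1 * h'1) \ot (h2 * h'2));
  piL1 : piL 1 = 1;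
  piL_sL : forall h h', piL (h * sL (piL h')) = piL (h * h');
  piL_tL : forall h h', piL (h * tL (piL h')) = piL (h * h')
}.

Record right_bialgebroid (H R : kalgebra k) := RightBialgebroid {
  sR : R -> H;
  tR : R -> H;
  gammaR : H -> tens (fun h r => h * sR r) (fun r h => h * tR r);
  piR : H -> R;
  right_coring := CoringData gammaR piR;
  sR_map : algebra_map sR;
  tR_map : anti_algebra_map tR;
  sR_tR_comm : forall r r', sR r * tR r' = tR r' * sR r;
  right_coringP : is_coring right_coring;
  gammaR_takeuchi : forall r h,
    \tsum_(h1, h2 <- gammaR h) ((sR r * h1) \ot h2)
    = \tsum_(h1, h2 <- gammaR h) (h1 \ot (tR r * h2))
    :> tens (fun h r => h * sR r) (fun r h => h * tR r);
  gammaR1 : gammaR 1 = 1 \ot 1;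
  gammaRM : forall h h',
    gammaR (h * h') =
      \tsum_(h1, h2 <- gammaR h) \tsum_(h'1, h'2 <- gammaR h')
        ((h1 * h'1) \ot (h2 * h'2));
  piR1 : piR 1 = 1;
  piR_sR : forall h h', piR (sR (piR h) * h') = piR (h * h');
  piR_tR : forall h h', piR (tR (piR h) * h') = piR (h * h')
}.

Record hopf_algebroid (H L R : kalgebra k) := HopfAlgebroid {
  HL : left_bialgebroid H L;
  HR : right_bialgebroid H R;
  antipode : H -> H;
  antipode_linear : k_linear antipode;
  sL_piL_tR : forall r, sL HL (piL HL (tR HR r)) = tR HR r;
  tL_piL_sR : forall r, tL HL (piL HL (sR HR r)) = sR HR r;
  sR_piR_tL : forall l, sR HR (piR HR (tL HL l)) = tL HL l;
  tR_piR_sL : forall l, tR HR (piR HR (sL HL l)) = sL HL l;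
  gammaL_gammaR : forall h,
    \tsum_(h1, h2 <- gammaR HR h) (gammaL HL h1 \ot h2)
    = \tsum_(h1, h2 <- gammaL HL h) \tsum_(h21, h22 <- gammaR HR h2)
        (h1 \ot h21) \ot h22
    :> tens (tact_right (fun h r => h * sR HR r)) (fun r h => h * tR HR r);
  gammaR_gammaL : forall h,
    \tsum_(h1, h2 <- gammaL HL h) (gammaR HR h1 \ot h2)
    = \tsum_(h1, h2 <- gammaR HR h) \tsum_(h21, h22 <- gammaL HL h2)
        (h1 \ot h21) \ot h22
    :> tens (tact_right (fun h l => tL HL l * h)) (fun l h => sL HL l * h);
  antipode_tLtR : forall l h r,
    antipode (tL HL l * h * tR HR r) = sR HR r * antipode h * sL HL l;
  antipode_left : forall h,
    \tsum_(h1, h2 <- gammaL HL h) (antipode h1 * h2) = sR HR (piR HR h);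
  antipode_right : forall h,
    \tsum_(h1, h2 <- gammaR HR h) (h1 * antipode h2) = sL HL (piL HL h)
}.

Definition left_over_right (H L R : kalgebra k) (HH : hopf_algebroid H L R) :
    extension_data (right_coring (HR HH)) (left_coring (HL HH)) :=
  @ExtensionData R L (right_coring (HR HH)) (left_coring (HL HH))
    (fun h l => tL (HL HH) l * h) (gammaL (HL HH)).

Definition right_over_left (H L R : kalgebra k) (HH : hopf_algebroid H L R) :
    extension_data (left_coring (HL HH)) (right_coring (HR HH)) :=
  @ExtensionData L R (left_coring (HL HH)) (right_coring (HR HH))
    (fun h r => h * sR (HR HH) r) (gammaR (HR HH)).

Definition pure_hopf_algebroid (H L R : kalgebra k)
    (HH : hopf_algebroid H L R) :=
  pure_right_extension (left_over_right HH)
  /\ pure_right_extension (right_over_left HH).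

(** * Comodule algebras *)

Record comodule_algebra (H R : kalgebra k) (B : right_bialgebroid H R)
    (A : kalgebra k) := ComoduleAlgebra {
  etaR : R -> A;
  coact : A -> tens (fun a r => a * etaR r) (@cleft_act R (right_coring B));
  etaR_map : algebra_map etaR;
  coact_comodule : is_comodule coact;
  (* The left R-action of the comodule A is the one given by etaR. *)
  coact_left_act : forall r a,
    etaR r * a = \tsum_(a0, a1 <- coact a) (a0 * etaR (piR B (sR B r * a1)));
  coactM : forall a a',
    coact (a * a') = \tsum_(a0, a1 <- coact a) \tsum_(a'0, a'1 <- coact a')
      ((a0 * a'0) \ot (a1 * a'1 : right_coring B));
  coact1 : coact 1 = 1 \ot (1 : H)
}.

Definition coinvariant (H R : kalgebra k) (B : right_bialgebroid H R)
    (A : kalgebra k) (CA : comodule_algebra B A) (t : A) :=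
  coact CA t = t \ot (1 : H).

Section AssociatedCoring.
Variables (H R : kalgebra k) (B : right_bialgebroid H R).
Variables (A : kalgebra k) (CA : comodule_algebra B A).

Definition AH : zmodType :=
  tens (fun a r => a * etaR CA r) (@cleft_act R (right_coring B)).

Definition AH_left (b : A) (t : AH) : AH := \tsum_(a, h <- t) ((b * a) \ot h).

Definition AH_right (t : AH) (a' : A) : AH :=
  \tsum_(a, h <- t) \tsum_(a'0, a'1 <- coact CA a')
    ((a * a'0) \ot ((h : H) * (a'1 : H) : right_coring B)).

Definition AH_copr (t : AH) : tens AH_right AH_left :=
  \tsum_(a, h <- t) \tsum_(h1, h2 <- gammaR B h)
    ((a \ot h1 : AH) \ot (1 \ot h2 : AH)).

Definition AH_counit (t : AH) : A := \tsum_(a, h <- t) (a * etaR CA (piR B h)).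

Definition assoc_coring : coring_data A := CoringData AH_copr AH_counit.

(* A as a right comodule of the associated coring, A \ot_A AH being AH *)
Definition assoc_coact (a : A) :
    tens (fun x y : A => x * y) (@cleft_act A assoc_coring) :=
  1 \ot (coact CA a : AH).

End AssociatedCoring.

Section CleftExtension.
Variables (H L R : kalgebra k) (HH : hopf_algebroid H L R).
Variables (A : kalgebra k) (CA : comodule_algebra (HR HH) A).

Definition left_over_assoc :
    extension_data (assoc_coring CA) (left_coring (HL HH)) :=
  @ExtensionData A L (assoc_coring CA) (left_coring (HL HH))
    (fun t l => \tsum_(a, h <- t) (a \ot (tL (HL HH) l * h : right_coring _)))
    (fun t => \tsum_(a, h <- t) \tsum_(h1, h2 <- gammaL (HL HH) h)
                ((a \ot h1 : AH CA) \ot h2)).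

(* A is an H-cleft extension of its coinvariant subalgebra *)
Definition cleft_extension :=
  exists etaL : L -> A,
    [/\ algebra_map etaL,
        forall l, coinvariant CA (etaL l)
      & exists lam lamb : H -> A,
        [/\ (forall l h, lam (sL (HL HH) l * h) = etaL l * lam h)
            /\ colinear (@copr R (right_coring (HR HH))) (coact CA) lam,
            [/\ additive_map lamb,
                forall h r, lamb (h * tR (HR HH) r) = etaR CA r * lamb h
              & forall l h, lamb (tL (HL HH) l * h) = lamb h * etaL l],
            forall h, \tsum_(h1, h2 <- gammaR (HR HH) h) (lam h1 * lamb h2)
                      = etaL (piL (HL HH) h)
          & forall h, \tsum_(h1, h2 <- gammaL (HL HH) h) (lamb h1 * lam h2)
                      = etaR CA (piR (HR HH) h)]].

End CleftExtension.
End HopfAlgebroids.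

(* Main.v *)
Require Import Defs.
From HB Require Import structures.
From mathcomp Require Import all_boot all_order all_algebra.
From mathcomp Require Import boolp.

Set Implicit Arguments.
Unset Strict Implicit.
Unset Printing Implicit Defensive.

Import GRing.Theory.
Local Open Scope ring_scope.

(** The maps of a cleft extension and those of a cleft bicomodule correspond to
   each other by lam = j and

     lamb h = jt (1 \ot h) 1,    jt (a \ot h) x = a * lamb h * x,

   with the same etaL. The conditions on both sides match as follows.
   - Left linearity of the coaction of A over the coring A \ot_R H is
     coinvariance of the image of etaL ([left_linear_coinvariant]): etaL l sends
     the coaction 1 \ot 1 of the unit to etaL l \ot 1.
   - lam(h^(1)) lamb(h^(2)) = etaL(pi_L h) is the condition on j <> jt
     ([lozengeE]).
   - The condition on jt . j at 1 \ot h says that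
     lamb(h_(1)) coact(lam(h_(2))) = 1 \ot h. The counit of A \ot_R H turns it
     into lamb(h_(1)) lam(h_(2)) = etaR(pi_R h), from which it follows in turn
     by colinearity of lam ([lamb_coact_lam]).
   - In the direction from cleft extensions, the compatibility of jt with the
     coproduct reduces to (1 \ot h^(1)) lamb(h^(2)) = lamb(h) \ot 1
     ([AH_right_lamb]): replace 1 \ot h^(1) by the previous expression and
     cancel lam against lamb.

   What remains is that j is colinear for the H_L-coaction of A induced by the
   extension, whereas lam is colinear for the given H_R-coaction
   ([colinear_assoc]). This is where purity enters. For an H_R-comodule (M, rho)
   purity implies that rho \ot_L H is injective and that an induced H_L-coaction
   rhoL is well defined by (rho \ot H) rhoL = (M \ot gamma_L) rho; then rhoL is a
   comodule structure ([ind_comodule]). An H_R-colinear map is H_L-colinear by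
   one mixed coassociativity law. For the converse one needs that rho can be
   recovered from rhoL, that is

     (rhoL \ot_R H) rho = (M \ot_L gamma_R) rhoL    ([coaction_exchange]).

   By purity of the other extension there is, for each m, an element v of
   M \ot_R H such that (rhoL \ot H) v = (M \ot gamma_R) (rhoL m). Mapping this
   to M \ot_R H \ot_L H \ot_R H along rho, and using injectivity for the
   H_L-comodule M \ot_R H, gives (rho \ot H) v = (rho \ot H) (rho m), and rho
   has a left inverse given by the counit. *)

(** * Calculus of tensor maps *)

Section Additive.
Variables (M N P : zmodType).

Lemma additive0 (f : M -> N) : additive_map f -> f 0 = 0.
Proof. by move=> fD; apply: (addrI (f 0)); rewrite -fD !addr0. Qed.

Lemma additive_comp (g : N -> P) (f : M -> N) :
  additive_map f -> additive_map g -> additive_map (fun x => g (f x)).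
Proof. by move=> fD gD x y; rewrite fD gD. Qed.

End Additive.

Definition rlinear (R : Type) (M M' : zmodType)
    (ra : M -> R -> M) (ra' : M' -> R -> M') (f : M -> M') :=
  additive_map f /\ forall x r, f (ra x r) = ra' (f x) r.

Definition llinear (R : Type) (N N' : zmodType)
    (la : R -> N -> N) (la' : R -> N' -> N') (g : N -> N') :=
  additive_map g /\ forall r y, g (la r y) = la' r (g y).

(** The part of a bimodule structure by which S acts, through N, by additive maps
   on M \ot N, while R acts on N by right S-linear maps. *)
Definition biaction (R S : Type) (N : zmodType)
    (la : R -> N -> N) (ra : N -> S -> N) :=
  (forall r, rlinear ra ra (la r)) /\ (forall s, additive_map (ra^~ s)).

Lemma biaction_llinear (R S : Type) (N : zmodType)
    (la : R -> N -> N) (ra : N -> S -> N) s :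
  biaction la ra -> llinear la la (ra^~ s).
Proof. by case=> laP raD; split=> // r y; case: (laP r) => _ ->. Qed.

Lemma bimodule_biaction (k : comPzRingType) (A B : kalgebra k) (M : zmodType)
    (la : A -> M -> M) (rb : M -> B -> M) :
  is_bimodule la rb -> biaction la rb.
Proof. by case=> [[lD _ _ _] [rD _ _ _] C _]; split=> // a; split. Qed.

Section Lift.
Variables (R : Type) (M N : zmodType) (ra : M -> R -> M) (la : R -> N -> N).
Implicit Types (t : tens ra la) (Z : zmodType).

Lemma tens_ext Z (F G : tens ra la -> Z) : additive_map F -> additive_map G ->
  (forall x y, F (x \ot y) = G (x \ot y)) -> F =1 G.
Proof.
move=> FD GD FG; elim/tens_ind => [|x y t IH]; first by rewrite !additive0.
by rewrite FD GD FG IH.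
Qed.

Lemma eq_tlift Z (F G : M -> N -> Z) t :
  (forall x y, F x y = G x y) -> tlift F t = tlift G t.
Proof. by move=> FG; apply: eq_bigr => p _. Qed.

(** Both sides are sums over one and the same representative of t. Nested
   Sweedler sums are fused by this identity, whatever their summands. *)
Lemma tlift_additive Z Z' (g : Z -> Z') (F : M -> N -> Z) t : additive_map g ->
  g (tlift F t) = \tsum_(x, y <- t) g (F x y).
Proof.
by move=> gD; rewrite /tlift /list_eval (big_morph g gD (additive0 gD)).
Qed.

Lemma tlift_add Z (F G : M -> N -> Z) t :
  \tsum_(x, y <- t) (F x y + G x y) = tlift F t + tlift G t.
Proof. exact: big_split. Qed.

Lemma tpureDl x x' y : (x + x') \ot y = x \ot y + x' \ot y :> tens ra la.
Proof. by case: (tpure_balanced ra la) => + _ _; apply. Qed.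

Lemma tpureDr x y y' : x \ot (y + y') = x \ot y + x \ot y' :> tens ra la.
Proof. by case: (tpure_balanced ra la) => _ + _; apply. Qed.

Lemma tpureM x r y : ra x r \ot y = x \ot la r y :> tens ra la.
Proof. by case: (tpure_balanced ra la) => _ _; apply. Qed.

Lemma tlift_pureE t : \tsum_(x, y <- t) (x \ot y) = t.
Proof.
apply: (tens_ext (F := fun t => _)) t => [|//|x y].
  exact/tliftD/tpure_balanced.
exact/tlift_pure/tpure_balanced.
Qed.

End Lift.

Section Tmap.
Variables (R : Type) (M N M' N' : zmodType).
Variables (ra : M -> R -> M) (la : R -> N -> N).
Variables (ra' : M' -> R -> M') (la' : R -> N' -> N').

Lemma tmap_balanced (f : M -> M') (g : N -> N') :
  rlinear ra ra' f -> llinear la la' g ->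
  balanced ra la (fun x y => f x \ot g y : tens ra' la').
Proof.
move=> [fD fr] [gD gl]; split=> [y x x'|x y y'|x r y] /=.
- by rewrite fD tpureDl.
- by rewrite gD tpureDr.
- by rewrite fr gl tpureM.
Qed.

Lemma tmap_pure (f : M -> M') (g : N -> N') x y :
  rlinear ra ra' f -> llinear la la' g ->
  tmap f g (x \ot y : tens ra la) = f x \ot g y :> tens ra' la'.
Proof. by move=> hf hg; rewrite /tmap tlift_pure //; exact: tmap_balanced. Qed.

Lemma tmap_additive (f : M -> M') (g : N -> N') :
  rlinear ra ra' f -> llinear la la' g ->
  additive_map (tmap f g : tens ra la -> tens ra' la').
Proof. by move=> hf hg; apply/tliftD/tmap_balanced. Qed.

Lemma eq_tmap (f f' : M -> M') (g g' : N -> N') (t : tens ra la) :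
  f =1 f' -> g =1 g' -> tmap f g t = tmap f' g' t :> tens ra' la'.
Proof. by move=> ff gg; apply: eq_tlift => x y; rewrite ff gg. Qed.

Lemma tmap_addl (f f' : M -> M') (g : N -> N') (t : tens ra la) :
  tmap (fun x => f x + f' x) g t = tmap f g t + tmap f' g t :> tens ra' la'.
Proof. by rewrite -tlift_add; apply: eq_tlift => x y; rewrite tpureDl. Qed.

Lemma tmap_addr (f : M -> M') (g g' : N -> N') (t : tens ra la) :
  tmap f (fun x => g x + g' x) t = tmap f g t + tmap f g' t :> tens ra' la'.
Proof. by rewrite -tlift_add; apply: eq_tlift => x y; rewrite tpureDr. Qed.

End Tmap.

(** By definition tmap f g t is a sum of pure tensors f x \ot g y, and tmap f' g'
   is additive with known values on these. *)
Lemma tmap_comp (R : Type) (M N M' N' M'' N'' : zmodType)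
    (ra : M -> R -> M) (la : R -> N -> N)
    (ra' : M' -> R -> M') (la' : R -> N' -> N')
    (ra'' : M'' -> R -> M'') (la'' : R -> N'' -> N'')
    (f : M -> M') (g : N -> N') (f' : M' -> M'') (g' : N' -> N'')
    (t : tens ra la) :
  rlinear ra' ra'' f' -> llinear la' la'' g' ->
  tmap f' g' (tmap f g t : tens ra' la')
  = tmap (fun x => f' (f x)) (fun y => g' (g y)) t :> tens ra'' la''.
Proof.
move=> hf hg; rewrite (tlift_additive (g := tmap f' g')); last first.
  exact: tmap_additive.
by apply: eq_tlift => x y; rewrite tmap_pure.
Qed.

Lemma tlift_tmap (R : Type) (M N M' N' Z : zmodType)
    (ra : M -> R -> M) (la : R -> N -> N)
    (ra' : M' -> R -> M') (la' : R -> N' -> N')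
    (F : M' -> N' -> Z) (f : M -> M') (g : N -> N') (t : tens ra la) :
  balanced ra' la' F ->
  tlift F (tmap f g t : tens ra' la') = \tsum_(x, y <- t) F (f x) (g y).
Proof.
move=> bF; rewrite [LHS](tlift_additive (g := tlift F)); last exact: tliftD.
by apply: eq_tlift => x y; exact: tlift_pure.
Qed.

Lemma tmap_id (R : Type) (M N : zmodType) (ra : M -> R -> M)
  (la : R -> N -> N) (t : tens ra la) : tmap id id t = t.
Proof. exact: tlift_pureE. Qed.

Section Bimodules.
Variables (R S : Type) (M N : zmodType).
Variables (ra : M -> R -> M) (la : R -> N -> N) (rs : N -> S -> N).
Hypothesis bN : biaction la rs.

Lemma tact_right_pure x y s :
  tact_right rs (x \ot y : tens ra la) s = x \ot rs y s.
Proof. by rewrite /tact_right tmap_pure //; exact: biaction_llinear. Qed.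

Lemma tact_right_additive s :
  additive_map (fun t : tens ra la => tact_right rs t s).
Proof. by apply: tmap_additive => //; exact: biaction_llinear. Qed.

Lemma rlinear_tpure x :
  rlinear rs (tact_right rs) (tpure x : N -> tens ra la).
Proof. by split=> [y y'|y s]; rewrite ?tpureDr ?tact_right_pure. Qed.

Lemma tmap_rlinear (M' : zmodType) (ra' : M' -> R -> M') (f : M -> M') :
  rlinear ra ra' f ->
  rlinear (tact_right rs) (tact_right rs) (tmap f id : tens ra la -> tens ra' la).
Proof.
move=> hf; split=> [|t s]; first exact: tmap_additive.
by rewrite /tact_right !tmap_comp //; exact: biaction_llinear.
Qed.

End Bimodules.

Lemma tact_right_rmodule (R : Type) (S : pzRingType) (M N : zmodType)
    (ra : M -> R -> M) (la : R -> N -> N) (rs : N -> S -> N) :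
  biaction la rs -> is_rmodule rs ->
  is_rmodule (tact_right rs : tens ra la -> S -> _).
Proof.
move=> bN [rD1 rD2 r1 rM]; split.
- by move=> s; apply: tact_right_additive.
- move=> t s s'; rewrite -tmap_addr; apply: eq_tmap => // y; exact: rD2.
- move=> t; rewrite -[RHS]tmap_id; exact: eq_tmap.
- move=> t s s'; rewrite /tact_right tmap_comp //; first exact: eq_tmap.
  exact: biaction_llinear.
Qed.

(** The map M \ot g, followed by reassociation to the left. The three-fold
   tensors in the laws of corings, comodules and extensions are all of the form
   [tcoact g t] or [tmap g id t]. *)
Definition tcoact (R S : Type) (M N N' P : zmodType)
    (ra : M -> R -> M) (la : R -> N -> N) (la' : R -> N' -> N')
    (rs : N' -> S -> N') (ls : S -> P -> P)
    (g : N -> tens rs ls) (t : tens ra la) :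
    tens (tact_right (ra := ra) (la := la') rs) ls :=
  \tsum_(m, n <- t) \tsum_(n', p <- g n) (m \ot n') \ot p.

Arguments tcoact {R S M N N' P ra la la' rs ls} g t.

Section Tcoact.
Variables (R S : Type) (M N N' P : zmodType).
Variables (ra : M -> R -> M) (la : R -> N -> N) (la' : R -> N' -> N').
Variables (rs : N' -> S -> N') (ls : S -> P -> P).
Hypothesis bN : biaction la' rs.
Variable g : N -> tens rs ls.
Hypothesis gP : llinear la (tact_left la') g.

Local Notation tcoactg :=
  (tcoact (la' := la') g : tens ra la -> tens (tact_right rs) ls).

Lemma tcoact_balanced : balanced ra la
  (fun m n => tmap (tpure m) id (g n)
              : tens (tact_right (ra := ra) (la := la') rs) ls).
Proof.
case: gP => gD gl; split=> [n m m'|m n n'|m r n] /=.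
- rewrite -tmap_addl; apply: eq_tmap => // x; exact: tpureDl.
- rewrite gD tmap_additive //; exact: rlinear_tpure.
- rewrite gl tmap_comp //; last exact: rlinear_tpure.
  by apply: eq_tmap => // x; exact: tpureM.
Qed.

(** As tpure m is right linear, this reduces identities between maps M \ot g to
   functoriality of [tmap]. *)
Lemma tcoact_pure m n :
  tcoactg (m \ot n : tens ra la) = tmap (tpure m) id (g n).
Proof. by rewrite /tcoact tlift_pure //; exact: tcoact_balanced. Qed.

Lemma tcoact_additive : additive_map tcoactg.
Proof. exact/tliftD/tcoact_balanced. Qed.

End Tcoact.

Section TcoactNaturality.
Variables (R S : Type) (M N N' P : zmodType).
Variables (ra : M -> R -> M) (la : R -> N -> N) (la' : R -> N' -> N').
Variables (rs : N' -> S -> N') (ls : S -> P -> P).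
Hypothesis bN : biaction la' rs.
Variable g : N -> tens rs ls.
Hypothesis gP : llinear la (tact_left la') g.

Lemma tcoact_natl (M' : zmodType) (ra' : M' -> R -> M') (f : M -> M')
    (t : tens ra la) : rlinear ra ra' f ->
  tmap (tmap f id) id (tcoact (la' := la') g t)
  = tcoact (la' := la') g (tmap f id t : tens ra' la).
Proof.
move=> hf.
have fr : rlinear (tact_right rs) (tact_right rs)
  (tmap f id : tens ra la' -> tens ra' la') by exact: tmap_rlinear.
apply: (tens_ext (F := fun t => tmap _ id (tcoact (la' := la') _ t))
                 (G := fun t => tcoact (la' := la') _ (tmap _ _ t))) t => [||m n].
- apply: additive_comp; [exact: tcoact_additive | exact: tmap_additive].
- apply: additive_comp; [exact: tmap_additive | exact: tcoact_additive].
rewrite tcoact_pure // tmap_comp // tmap_pure // tcoact_pure //.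
by apply: eq_tmap => // x; rewrite tmap_pure.
Qed.

End TcoactNaturality.

Lemma tcoact_rlinear (R S U : Type) (M N N' P : zmodType)
    (ra : M -> R -> M) (la : R -> N -> N) (la' : R -> N' -> N')
    (rs : N' -> S -> N') (ls : S -> P -> P) (ru : N -> U -> N)
    (rp : P -> U -> P) (g : N -> tens rs ls) :
  biaction la ru -> biaction la' rs -> biaction ls rp ->
  llinear la (tact_left la') g -> rlinear ru (tact_right rp) g ->
  rlinear (tact_right ru) (tact_right rp)
    (tcoact (la' := la') g : tens ra la -> _).
Proof.
move=> b b' bp gl gr; split=> [|t u]; first exact: tcoact_additive.
apply: (tens_ext (F := fun t => tcoact g (tact_right _ t u))
                 (G := fun t => tact_right _ (tcoact g t) u)) t => [||m n].
- apply: additive_comp; first exact: tact_right_additive.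
  exact: tcoact_additive.
- apply: (additive_comp (g := fun t => tact_right _ t u)).
    exact: tcoact_additive.
  exact: tact_right_additive.
- rewrite tact_right_pure // !tcoact_pure //; case: gr => _ ->.
  by have [_ ->] := tmap_rlinear bp (rlinear_tpure ra b' m).
Qed.

Section TcoactTcoact.
Variables (R S U : Type) (M N N1 N2 P P1 Q : zmodType).
Variables (ra : M -> R -> M) (la : R -> N -> N) (la1 : R -> N1 -> N1).
Variables (la2 : R -> N2 -> N2).
Variables (ru1 : N1 -> U -> N1) (rs2 : N2 -> S -> N2).
Variables (lq : U -> Q -> Q) (lp : S -> P -> P) (lp1 : S -> P1 -> P1).
Variable (rp1 : P1 -> U -> P1).
Hypotheses (b1 : biaction la1 ru1) (b2 : biaction la2 rs2).
Hypothesis (bp1 : biaction lp1 rp1).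
Variables (g1 : N -> tens ru1 lq) (g2 : N1 -> tens rs2 lp1).
Variables (g3 : N -> tens rs2 lp) (g4 : P -> tens rp1 lq).
Hypotheses (g1P : llinear la (tact_left la1) g1).
Hypotheses (g2P : llinear la1 (tact_left la2) g2).
Hypotheses (g2r : rlinear ru1 (tact_right rp1) g2).
Hypotheses (g3P : llinear la (tact_left la2) g3).
Hypotheses (g4P : llinear lp (tact_left lp1) g4).

(** Coassociativity of N, for two possibly different coactions, passes to
   M \ot N. *)
Lemma tcoact_tcoact (t : tens ra la) :
  (forall n, tmap g2 id (g1 n) = tcoact g4 (g3 n)) ->
  tmap (tcoact (la' := la2) g2) id (tcoact (la' := la1) g1 t)
  = tcoact (la' := lp1) g4 (tcoact (la' := la2) g3 t).
Proof.
move=> gg.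
have gr : rlinear (tact_right ru1) (tact_right rp1)
  (tcoact (la' := la2) g2 : tens ra la1 -> _).
  exact: tcoact_rlinear.
apply: (tens_ext
  (F := fun t => tmap (tcoact g2) id (tcoact (la' := la1) g1 t))
  (G := fun t => tcoact (la' := lp1) g4 (tcoact (la' := la2) g3 t))) t
  => [||m n].
- apply: additive_comp; first exact: tcoact_additive.
  exact: tmap_additive.
- apply: additive_comp; exact: tcoact_additive.
rewrite !tcoact_pure // tmap_comp //.
rewrite -tcoact_natl //; last exact: rlinear_tpure.
rewrite -gg tmap_comp //; last exact/tmap_rlinear/rlinear_tpure.
by apply: eq_tmap => // x; rewrite tcoact_pure.
Qed.

End TcoactTcoact.

(** M \ot e followed by the isomorphism M \ot R = M; counit laws and induced
   actions are of this form. *)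
Definition tcontr (R : Type) (M N : zmodType) (ra : M -> R -> M)
    (la : R -> N -> N) (e : N -> R) (t : tens ra la) : M :=
  \tsum_(m, n <- t) ra m (e n).

Definition functional (R : pzRingType) (N : zmodType) (la : R -> N -> N)
    (e : N -> R) :=
  additive_map e /\ forall r n, e (la r n) = r * e n.

Section Tcontr.
Variables (R : pzRingType) (M N : zmodType) (ra : M -> R -> M).
Variables (la : R -> N -> N) (e : N -> R).
Hypotheses (rM : is_rmodule ra) (eP : functional la e).

Lemma tcontr_balanced : balanced ra la (fun m n => ra m (e n)).
Proof.
case: rM eP => r1 r2 _ rA [eD el]; split=> [n m m'|m n n'|m r n] /=.
- exact: r1.
- by rewrite eD r2.
- by rewrite el rA.
Qed.

Lemma tcontr_pure m n : tcontr e (m \ot n : tens ra la) = ra m (e n).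
Proof. by rewrite /tcontr tlift_pure //; exact: tcontr_balanced. Qed.

Lemma tcontr_additive : additive_map (tcontr e : tens ra la -> M).
Proof. exact/tliftD/tcontr_balanced. Qed.

End Tcontr.

Lemma tcontr_nat (R : pzRingType) (M M' N : zmodType) (ra : M -> R -> M)
    (ra' : M' -> R -> M') (la : R -> N -> N) (e : N -> R) (f : M -> M')
    (t : tens ra la) :
  is_rmodule ra -> is_rmodule ra' -> functional la e -> rlinear ra ra' f ->
  f (tcontr e t) = tcontr e (tmap f id t : tens ra' la).
Proof.
move=> rM rM' eP [fD fr].
apply: (tens_ext (F := fun t => f (tcontr e t))
                 (G := fun t => tcontr e (tmap f id t))) t => [||m n].
- by apply: additive_comp => //; exact: tcontr_additive.
- by apply: additive_comp; [exact: tmap_additive | exact: tcontr_additive].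
- by rewrite tmap_pure // !tcontr_pure.
Qed.

Lemma tcontr_tmap (R : pzRingType) (M N N' : zmodType) (ra : M -> R -> M)
    (la : R -> N -> N) (la' : R -> N' -> N') (e : N' -> R) (g : N -> N')
    (t : tens ra la) :
  is_rmodule ra -> functional la' e -> llinear la la' g ->
  tcontr e (tmap id g t : tens ra la') = tcontr (fun n => e (g n)) t.
Proof.
move=> rM eP [gD gl]; rewrite (tlift_additive (g := tcontr e)); last first.
  exact: tcontr_additive.
by apply: eq_tlift => x y; rewrite tcontr_pure.
Qed.

Section TcontrTcoact.
Variables (R : Type) (S : pzRingType) (M N N' P : zmodType).
Variables (ra : M -> R -> M) (la : R -> N -> N) (la' : R -> N' -> N').
Variables (rs : N' -> S -> N') (ls : S -> P -> P).
Hypotheses (bN : biaction la' rs) (rM : is_rmodule rs).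
Variable g : N -> tens rs ls.
Hypothesis gP : llinear la (tact_left la') g.
Variable e : P -> S.
Hypothesis eP : functional ls e.

Lemma tcontr_llinear : llinear la la' (fun n => tcontr e (g n)).
Proof.
case: gP => gD gl; split=> [n n'|r n].
  by rewrite gD tcontr_additive.
by rewrite gl -(tcontr_nat (f := la' r)) //; case: bN => + _; apply.
Qed.

Lemma tcontr_tcoact (t : tens ra la) :
  tcontr e (tcoact (la' := la') g t) = tmap id (fun n => tcontr e (g n)) t.
Proof.
have tM := tact_right_rmodule ra bN rM.
apply: (tens_ext (F := fun t => tcontr e (tcoact g t))
                 (G := fun t => tmap _ _ t)) t => [||m n].
- by apply: additive_comp; [exact: tcoact_additive | exact: tcontr_additive].
- by apply: tmap_additive => //; exact: tcontr_llinear.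
rewrite tcoact_pure // tmap_pure //; last exact: tcontr_llinear.
by rewrite -(tcontr_nat (f := tpure m)) //; exact: rlinear_tpure.
Qed.

End TcontrTcoact.

(** * Comodules along a pure coring extension *)

Section Corings.
Variables (k : comPzRingType) (A : kalgebra k) (C : coring_data A).
Hypothesis CP : is_coring C.

Lemma coring_biaction : biaction (@cleft_act A C) (@cright_act A C).
Proof. by case: CP => /bimodule_biaction. Qed.

Lemma coring_rmodule : is_rmodule (@cright_act A C).
Proof. by case: CP => -[]. Qed.

Lemma copr_llinear : llinear (@cleft_act A C) (tact_left cleft_act) (@copr A C).
Proof. by case: CP => _ ? _ _ _ [] *; split. Qed.

Lemma counit_functional : functional (@cleft_act A C) counit.
Proof. by case: CP. Qed.

Lemma tcontr_counit_rlinear (M : zmodType) (ra : M -> A -> M) :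
  is_rmodule ra ->
  rlinear (tact_right cright_act) ra
    (tcontr counit : tens ra (@cleft_act A C) -> M).
Proof.
move=> rM; have cf := counit_functional.
split=> [|t a]; first exact: tcontr_additive.
rewrite /tact_right (tcontr_tmap (la := cleft_act)) //; last first.
  exact/biaction_llinear/coring_biaction.
case: rM => rD _ _ rA; rewrite [RHS](tlift_additive (g := ra^~ a)) //.
by apply: eq_tlift => m n; case: CP => _ _ _ _ -> _ _; rewrite rA.
Qed.

End Corings.

Section Injectivity.
Variables (A : pzRingType) (C : coring_data A) (M : zmodType).
Variables (ra : M -> A -> M) (rho : M -> tens ra (@cleft_act A C)).

(** The counit splits a coaction. *)
Lemma coaction_inj : is_comodule rho -> injective rho.
Proof. by move=> MP; apply: (can_inj (g := tcontr counit)); case: MP. Qed.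

End Injectivity.

Section Extension.
Variables (k : comPzRingType) (A L : kalgebra k).
Variables (C : coring_data A) (D : coring_data L) (E : extension_data C D).
Hypotheses (CP : is_coring C) (DP : is_coring D).
Hypothesis EP : is_right_extension E.

Lemma ext_biaction : biaction (@cleft_act A C) (@ext_act _ _ _ _ E).
Proof. by case: EP => /bimodule_biaction. Qed.

Lemma ext_rmodule : is_rmodule (@ext_act _ _ _ _ E).
Proof. by case: EP => -[]. Qed.

Lemma ext_coact_llinear :
  llinear (@cleft_act A C) (tact_left cleft_act) (@ext_coact _ _ _ _ E).
Proof. by case: EP => _ [] *; split. Qed.

Lemma ext_coact_rlinear :
  rlinear (@ext_act _ _ _ _ E) (tact_right cright_act) (@ext_coact _ _ _ _ E).
Proof. by case: EP => _ [] *; split. Qed.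

Lemma copr_ext_rlinear :
  rlinear (@ext_act _ _ _ _ E) (tact_right (@ext_act _ _ _ _ E)) copr.
Proof. by case: EP => _ _ _ + _; case: CP => _ _ _ _ _ [] *; split. Qed.

(** The extension coaction on C makes M \ot C a D-comodule for any M. *)
Lemma cofree_comodule (M : zmodType) (ra : M -> A -> M) :
  is_comodule (tcoact (@ext_coact _ _ _ _ E)
    : tens ra (@cleft_act A C) -> tens (tact_right (@ext_act _ _ _ _ E)) _).
Proof.
have bE := ext_biaction; have gE := ext_coact_llinear.
have bD := coring_biaction DP.
split.
- exact: tact_right_rmodule ext_biaction ext_rmodule.
- exact: tcoact_additive.
- by move=> t l; have [_ ->] := tcoact_rlinear ra bE bE bD gE ext_coact_rlinear.
- move=> t; apply: tcoact_tcoact => //; first exact: ext_coact_rlinear.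
    exact: copr_llinear.
  by case: EP => _ [].
- move=> t; rewrite -[RHS]tmap_id.
  rewrite -[LHS]/(tcontr counit (tcoact (@ext_coact _ _ _ _ E) t)).
  rewrite tcontr_tcoact //; first 1 last.
  + exact: ext_rmodule.
  + exact: counit_functional.
  by apply: eq_tmap => // c; exact: comod_counit (ext_comodule EP) c.
Qed.

Lemma counit_ext_functional l :
  functional (@cleft_act A C) (fun c => counit (ext_act E c l)).
Proof.
have [eD el] := counit_functional CP; have [bl br] := ext_biaction.
split=> [c d|a c]; first by rewrite br eD.
by case: (bl a) => _ <-; rewrite el.
Qed.

(** The counit law for c l, as the coproduct is right L-linear. This is the only
   computation needed to identify induced actions. *)
Lemma tcontr_copr_ext c l :
  tcontr (fun c => counit (ext_act E c l)) (copr c) = ext_act E c l.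
Proof.
rewrite -(tcontr_tmap (la' := @cleft_act A C)
            (g := fun c => ext_act E c l) (e := counit)) //;
  [|exact: coring_rmodule|exact: counit_functional
   |exact/biaction_llinear/ext_biaction].
rewrite -[tmap _ _ _]/(tact_right (ext_act E) (copr c) l).
have [_ <-] := copr_ext_rlinear.
exact: comod_counit (copr_comodule CP) _.
Qed.

Section InducedAction.
Variables (M : zmodType) (ra : M -> A -> M).
Variable rho : M -> tens ra (@cleft_act A C).
Hypothesis MP : is_comodule rho.

(** The induced action is the one that M inherits from M \ot_A C along rho. *)
Lemma coaction_ind_act m l :
  rho (ind_act E rho m l) = tact_right (ext_act E) (rho m) l.
Proof.
have ef := counit_ext_functional l; have bC := coring_biaction CP.
have cM := coring_rmodule CP.
rewrite -[ind_act _ _ _ _]/(tcontr (fun c => counit (ext_act E c l)) (rho m)).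
have rr : rlinear ra (tact_right cright_act) rho by case: MP.
rewrite (tcontr_nat (ra' := tact_right (@cright_act A C)) (f := rho)) //;
  [|by case: MP|exact: tact_right_rmodule].
rewrite [tmap rho id _](comod_coassoc MP).
rewrite -[X in tcontr _ X]/(tcoact copr (rho m)) tcontr_tcoact //;
  last exact: copr_llinear.
apply: eq_tmap => // c; exact: tcontr_copr_ext.
Qed.

Lemma ind_act_rlinear : rlinear (ind_act E rho) (tact_right (ext_act E)) rho.
Proof. by split; [case: MP | exact: coaction_ind_act]. Qed.

Lemma ind_act_rmodule : is_rmodule (ind_act E rho).
Proof.
have rI := coaction_inj MP; have rD := comod_additive MP.
have [e1 e2 e3 e4] := tact_right_rmodule ra ext_biaction ext_rmodule.
split=> [l x y|x l l'|x|x l l']; apply: rI; rewrite ?rD !coaction_ind_act ?rD.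
- exact: e1.
- exact: e2.
- exact: e3.
- exact: e4.
Qed.

End InducedAction.

Lemma ind_coact_spec (M : zmodType) (ra : M -> A -> M)
    (rho : M -> tens ra (@cleft_act A C)) m :
  (exists t, is_ind_coact (E := E) (rho := rho) m t) ->
  is_ind_coact m (ind_coact E rho m).
Proof. by rewrite /ind_coact; case: pselect => // ex _; case: cid. Qed.

Hypothesis pureE : preserves_comodule_equalizers E.

Section PureInduced.
Variables (M : zmodType) (ra : M -> A -> M).
Variable rho : M -> tens ra (@cleft_act A C).
Hypothesis MP : is_comodule rho.

Local Notation iact := (ind_act E rho).
Local Notation MD := (tens iact (@cleft_act L D)).
Local Notation rhoD :=
  (tmap rho id : MD -> tens (tact_right (ext_act E)) (@cleft_act L D)).

(** Purity concerns - \ot D \ot D, of which - \ot D is a retract, naturally, by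
   the coproduct and the counit of D. *)
Lemma coaction_tensD_inj : injective rhoD.
Proof.
move=> t t' tt.
have [inj _] := pureE MP; have bD := coring_biaction DP.
have gD := copr_llinear DP; have rr := ind_act_rlinear MP.
have eK (u : MD) : tcontr counit (tcoact (la' := cleft_act) copr u) = u.
  rewrite tcontr_tcoact //; [|exact: coring_rmodule|exact: counit_functional].
  rewrite -[RHS]tmap_id; apply: eq_tmap => // d.
  exact: comod_counit (copr_comodule DP) d.
rewrite -[t]eK -[t']eK; congr tcontr; apply: inj.
by rewrite /tensDD_map !tcoact_natl // tt.
Qed.

(** By the same retraction the equalizer given by rho is preserved by - \ot D,
   and y = (M \ot ext_coact)(rho m) equalizes the two maps. *)
Lemma is_ind_coact_exists m : exists t, is_ind_coact (E := E) (rho := rho) m t.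
Proof.
have [_ eqz] := pureE MP; have bD := coring_biaction DP.
have gD := copr_llinear DP; have rr := ind_act_rlinear MP.
have bE := ext_biaction; have gE := ext_coact_llinear.
have bC := coring_biaction CP; have gC := copr_llinear CP.
have rC : rlinear ra (tact_right cright_act) rho by case: MP.
pose y := tcoact (la' := cleft_act) (@ext_coact _ _ _ _ E) (rho m).
have dM : is_rmodule (@cright_act L D) by exact: coring_rmodule.
have eD := counit_functional DP.
have yE : tmap (tmap rho id) id y = tmap (tcoact (la' := cleft_act) copr) id y
    :> tens (tact_right (@ext_act _ _ _ _ E)) cleft_act.
  rewrite /y tcoact_natl // [tmap rho id _](comod_coassoc MP).
  symmetry; apply: tcoact_tcoact => //; first exact: copr_ext_rlinear.
  by case: EP.
have rrho := tmap_rlinear bE rC.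
have rcopr := tcoact_rlinear ra bE bC bE gC copr_ext_rlinear.
case: (eqz (tcoact (la' := cleft_act) copr y)) => -[].
  apply: etrans (tcoact_natl bD gD y rrho) _.
  by apply: etrans (esym (tcoact_natl bD gD y rcopr)); rewrite yE.
move=> u uE _; exists (tcontr counit u).
have cM (X : zmodType) (rx : X -> L -> X) : is_rmodule
  (tact_right cright_act : tens rx (@cleft_act L D) -> _ -> _).
  exact: tact_right_rmodule.
rewrite /is_ind_coact.
rewrite (tcontr_nat (ra' := tact_right (@cright_act L D)) (f := rhoD)) //;
  last exact: tmap_rlinear.
move: uE; rewrite /tensDD_map => ->.
rewrite tcontr_tcoact // -[RHS]tmap_id; apply: eq_tmap => // d.
exact: comod_counit (copr_comodule DP) d.
Qed.

Lemma ind_coactP m :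
  rhoD (ind_coact E rho m)
  = tcoact (la' := cleft_act) (@ext_coact _ _ _ _ E) (rho m).
Proof. exact/ind_coact_spec/is_ind_coact_exists. Qed.

(** Every axiom holds after the injective map rho \ot D, which carries the
   induced coaction to the one of M \ot C. *)
Lemma ind_comodule : is_comodule (ind_coact E rho).
Proof.
have bD := coring_biaction DP; have gD := copr_llinear DP.
have bE := ext_biaction; have gE := ext_coact_llinear.
have rr := ind_act_rlinear MP; have rD := tmap_rlinear bD rr.
have FP := cofree_comodule ra.
have tr := tcoact_rlinear ra bE bE bD gE ext_coact_rlinear.
split.
- exact: ind_act_rmodule.
- move=> x y; apply: coaction_tensD_inj; case: rD => -> _.
  by rewrite !ind_coactP (comod_additive MP); case: tr => ->.
- move=> m l; apply: coaction_tensD_inj; case: rD => _ ->.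
  by rewrite !ind_coactP coaction_ind_act //; case: tr => _ ->.
- move=> m; have [inj _] := pureE MP; apply: inj; rewrite /tensDD_map.
  rewrite -[X in tmap _ _ X = _]/(tmap (ind_coact E rho) id (ind_coact E rho m)).
  rewrite -[X in _ = tmap _ _ X]/(tcoact copr (ind_coact E rho m)).
  rewrite tcoact_natl // ind_coactP tmap_comp //.
  transitivity (tmap (fun x => tcoact (la' := cleft_act)
      (@ext_coact _ _ _ _ E) (rho x)) id (ind_coact E rho m)
    : tens (tact_right (@cright_act L D)) (@cleft_act L D)).
    by apply: eq_tmap => // x; exact: ind_coactP.
  rewrite -[RHS](comod_coassoc FP).
  rewrite -[RHS]/(tmap (tcoact _) id _) -ind_coactP tmap_comp //.
- move=> m; apply: (coaction_inj MP).
  rewrite -[X in rho X]/(tcontr counit (ind_coact E rho m)).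
  rewrite (tcontr_nat (ra' := tact_right (@ext_act _ _ _ _ E)) (f := rho)) //;
    [|exact: ind_act_rmodule|by case: FP|exact: counit_functional].
  by rewrite ind_coactP; exact: comod_counit FP (rho m).
Qed.

End PureInduced.
End Extension.

(** * Comodules of the two bialgebroids of a pure Hopf algebroid *)

Section HopfComodules.
Variables (k : comPzRingType) (H L R : kalgebra k).
Variables (HH : hopf_algebroid H L R) (pureHH : pure_hopf_algebroid HH).

Local Notation CL := (left_coring (HL HH)).
Local Notation CR := (right_coring (HR HH)).
Local Notation EL := (left_over_right HH).
Local Notation ER := (right_over_left HH).
Local Notation gL := (@copr L CL).
Local Notation gR := (@copr R CR).

Variables (M : zmodType) (ra : M -> R -> M).
Variable rho : M -> tens ra (@cleft_act R CR).
Hypothesis MP : is_comodule rho.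

Local Notation rhoL := (ind_coact EL rho).

Let CLP := left_coringP (HL HH).
Let CRP := right_coringP (HR HH).
Let ELP := pureHH.1.1.
Let ELpure := pureHH.1.2.
Let ERP := pureHH.2.1.
Let ERpure := pureHH.2.2.

Lemma ind_comoduleL : is_comodule rhoL.
Proof. exact: ind_comodule. Qed.

(** Along the injective map rho, the action induced back from rhoL becomes the
   right R-action of M \ot_R H. *)
Lemma ind_act_rhoL m r : ind_act ER rhoL m r = ra m r.
Proof.
apply: (coaction_inj MP).
pose e := fun h => counit (ext_act ER h r).
have eP : functional (@cleft_act L CL) e by exact: counit_ext_functional.
rewrite -[ind_act _ _ _ _]/(tcontr e (rhoL m)).
rewrite (tcontr_nat (ra' := tact_right (ext_act EL)) (f := rho)) //; first last.
- exact: ind_act_rlinear.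
- exact: tact_right_rmodule (ext_biaction ELP) (ext_rmodule ELP).
- exact: ind_act_rmodule.
rewrite ind_coactP // tcontr_tcoact //; first last.
- exact: ext_coact_llinear.
- exact: ext_rmodule.
- exact: ext_biaction.
rewrite (comod_linear MP); apply: eq_tmap => // h.
exact: (tcontr_copr_ext CLP ERP h r).
Qed.

(** The H_L-comodule M \ot_R H is induced from the H_R-comodule M \ot_R H, and
   the R-action induced back from it is the original one. *)
Lemma ind_act_cofree t r :
  ind_act ER (tcoact (la' := @cleft_act R CR) (@ext_coact _ _ _ _ EL)
              : tens ra (@cleft_act R CR) -> _) t r
  = tact_right (@cright_act R CR) t r.
Proof.
pose e := fun h => counit (ext_act ER h r).
have eP : functional (@cleft_act L CL) e by exact: counit_ext_functional.
rewrite -[ind_act _ _ _ _]/(tcontr e (tcoact (@ext_coact _ _ _ _ EL) t)).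
rewrite tcontr_tcoact //; first last.
- exact: ext_coact_llinear.
- exact: ext_rmodule.
- exact: ext_biaction.
apply: eq_tmap => // h; exact: (tcontr_copr_ext CLP ERP h r).
Qed.

(** Inducing from H_R to H_L and back gives the original coaction. Purity of
   both extensions is used: for the existence of the coaction v induced back, and
   for the injectivity by which v is compared with rho m. *)
Lemma coaction_exchange m :
  tmap rhoL id (rho m) = tcoact (la' := @cleft_act L CL) gR (rhoL m)
  :> tens (tact_right (fun h r => h * sR (HR HH) r)) (fun r h => h * tR (HR HH) r).
Proof.
have LP := ind_comoduleL.
have FP := cofree_comodule CLP ELP ra.
have Era : ind_act ER rhoL = ra.
  by apply/funext => x; apply/funext => r; exact: ind_act_rhoL.
have EF := funext (fun t => funext (ind_act_cofree t)).
have [v] := is_ind_coact_exists CLP CRP ERP ERpure LP m.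
rewrite /is_ind_coact; move: v; rewrite Era => v vE.
(* Injectivity for the H_L-comodule M \ot_R H, into which rho maps M. *)
have inj := coaction_tensD_inj CLP CRP ERP ERpure FP.
move: inj; rewrite EF => inj.
suff -> : rho m = v by exact: vE.
have rr : rlinear ra (tact_right (@cright_act R CR)) rho by case: MP.
have bC := coring_biaction CRP; have bE := ext_biaction ELP.
have rI : injective (tmap rho id : tens ra (@cleft_act R CR) ->
    tens (tact_right (@cright_act R CR)) (@cleft_act R CR)).
  apply: (can_inj (g := tmap (tcontr counit) id)) => t.
  rewrite tmap_comp //.
    by rewrite -[RHS]tmap_id; apply: eq_tmap => // x; exact: comod_counit MP x.
  by apply: tcontr_counit_rlinear => //; case: MP.
have gLl := ext_coact_llinear ELP; have gRl := copr_llinear CRP.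
have bER := ext_biaction ERP.
have Fr := tcoact_rlinear ra bC bE bER gLl (copr_ext_rlinear CLP ERP).
have rhor := tmap_rlinear bER (ind_act_rlinear CRP ELP MP).
apply: rI; apply: inj; rewrite [tmap rho id (rho m)](comod_coassoc MP).
have gLR : forall h, tmap gL id (gR h) = tcoact (la' := @cleft_act L CL) gR (gL h)
    :> tens (tact_right (@ext_act _ _ _ _ ER)) (@cleft_act R CR).
  exact: gammaL_gammaR.
apply: etrans (tcoact_tcoact bC bE bER gRl gLl (copr_ext_rlinear CLP ERP) gLl
  (ext_coact_llinear ERP) (rho m) gLR) _.
rewrite tmap_comp //.
transitivity (tmap (tmap rho id : tens (ind_act EL rho) (@cleft_act L CL) ->
      tens (tact_right (@ext_act _ _ _ _ EL)) (@cleft_act L CL)) id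
    (tmap rhoL id v : tens (tact_right (@ext_act _ _ _ _ ER)) (@cleft_act R CR))
   : tens (tact_right (@ext_act _ _ _ _ ER)) (@cleft_act R CR)); last first.
  rewrite tmap_comp //; apply: eq_tmap => // x; exact: ind_coactP.
rewrite vE tcoact_natl //; first 1 last.
- exact: ext_coact_llinear.
- exact: ind_act_rlinear.
by congr tcoact; rewrite ind_coactP.
Qed.

Variable p : H -> M.

(** Left colinearity of p, phrased after the embedding of M \ot_L H in
   M \ot_R H \ot_L H so as not to mention the induced coaction. *)
Definition left_colinear :=
  [/\ additive_map p,
      forall l h, p (tL (HL HH) l * h) = ind_act EL rho (p h) l
    & forall h, tmap (fun x => rho (p x)) id (gL h)
        = tcoact (la' := @cleft_act R CR) gL (rho (p h))
        :> tens (tact_right (@ext_act _ _ _ _ EL)) (@cleft_act L CL)].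

(** The law (gamma_R \ot H) gamma_L = (H \ot gamma_L) gamma_R, transported along
   p. *)
Lemma colinear_left_colinear : colinear gR rho p -> left_colinear.
Proof.
move=> [pD pr pc].
have bE := ext_biaction ELP; have gLl := ext_coact_llinear ELP.
have pR : rlinear (@cright_act R CR) ra p by [].
split=> // [l h|h].
  rewrite -[ind_act _ _ _ _]/(tcontr (fun c => counit (ext_act EL c l)) (rho (p h))).
  rewrite pc.
  rewrite -(tcontr_nat (ra := @cright_act R CR)) //; first 1 last.
  - exact: coring_rmodule.
  - by case: MP.
  - exact: counit_ext_functional.
  by rewrite (tcontr_copr_ext CRP ELP h l).
have gRL : tmap gR id (gL h) = tcoact (la' := @cleft_act R CR) gL (gR h)
    :> tens (tact_right (@ext_act _ _ _ _ EL)) (@cleft_act L CL).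
  exact: gammaR_gammaL.
rewrite pc; apply: etrans (tcoact_natl bE gLl (gR h) pR).
rewrite -[X in _ = tmap _ _ X]gRL tmap_comp //; last exact: tmap_rlinear.
by apply: eq_tmap => // x; exact: pc.
Qed.

(** The two sides of the colinearity condition in M \ot_R H are compared after
   the injection rhoL \ot H, where [coaction_exchange] and the other mixed
   coassociativity law apply. *)
Lemma left_colinear_colinear : left_colinear -> colinear gR rho p.
Proof.
move=> [pD pl pc].
have LP := ind_comoduleL; have rr := ind_act_rlinear CRP ELP MP.
have bE := ext_biaction ERP; have gRl := ext_coact_llinear ERP.
have pL : rlinear (@ext_act _ _ _ _ EL) (ind_act EL rho) p.
  by split=> [//|h l]; exact: pl.
have pcL h : rhoL (p h) = tmap p id (gL h).
  apply: (coaction_tensD_inj CRP CLP ELP ELpure MP).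
  by rewrite ind_coactP // tmap_comp.
have pr h r : p (@cright_act R CR h r) = ra (p h) r.
  rewrite -ind_act_rhoL -[RHS]/(tcontr (fun c => counit (ext_act ER c r))
                                         (rhoL (p h))) pcL.
  rewrite -(tcontr_nat (ra := @ext_act _ _ _ _ EL)) //; first 1 last.
  - exact: ext_rmodule.
  - exact: ind_act_rmodule.
  - exact: counit_ext_functional.
  by congr p; symmetry; exact: (tcontr_copr_ext CLP ERP h r).
split=> // h.
have inj := coaction_tensD_inj CLP CRP ERP ERpure LP.
have Era : ind_act ER rhoL = ra.
  by apply/funext => x; apply/funext => r; exact: ind_act_rhoL.
rewrite Era in inj; apply: inj.
have pR : rlinear (@cright_act R CR) ra p by [].
have rhoLr : rlinear ra (tact_right (@ext_act _ _ _ _ ER)) rhoL.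
  by have := ind_act_rlinear CLP ERP LP; rewrite Era.
have gLR : tmap gL id (gR h) = tcoact (la' := @cleft_act L CL) gR (gL h)
    :> tens (tact_right (@ext_act _ _ _ _ ER)) (@cleft_act R CR).
  exact: gammaL_gammaR.
rewrite tmap_comp //; apply: etrans (coaction_exchange (p h)) _.
rewrite pcL; apply: etrans (esym (tcoact_natl bE gRl (gL h) pL)) _.
rewrite -[X in tmap _ _ X = _]gLR tmap_comp //; last exact: tmap_rlinear.
by apply: eq_tmap => // x; rewrite pcL.
Qed.

End HopfComodules.

(** * Comodule algebras and the associated coring *)

Section ComoduleAlgebra.
Variables (k : comPzRingType) (H R : kalgebra k).
Variables (B : right_bialgebroid H R) (A : kalgebra k).
Variable CA : comodule_algebra B A.

Local Notation CR := (right_coring B).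
Local Notation AH := (AH CA).
Local Notation AC := (assoc_coring CA).
Local Notation coact := (coact CA).
Local Notation etaR := (etaR CA).
Local Notation raA := (fun (a : A) (r : R) => a * etaR r).

Let MP := coact_comodule CA.
Let CRP := right_coringP B.
Let bC := coring_biaction CRP.

Lemma mulr_additive (K : pzRingType) (a : K) : additive_map (fun x => a * x).
Proof. by move=> x y; rewrite mulrDr. Qed.

Lemma mull_additive (K : pzRingType) (a : K) : additive_map (fun x => x * a).
Proof. by move=> x y; rewrite mulrDl. Qed.

Lemma rlinear_mul (a : A) : rlinear raA raA (fun x => a * x).
Proof. by split=> [|x r]; [exact: mulr_additive | rewrite mulrA]. Qed.

Lemma llinear_mul (h : H) :
  llinear (@cleft_act R CR) (@cleft_act R CR) (fun x => h * x : H).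
Proof. by split=> [|r x] /=; [exact: mulr_additive | rewrite mulrA]. Qed.

Lemma etaRM r r' : etaR (r * r') = etaR r * etaR r'.
Proof. by case: (etaR_map CA) => _ [] _; apply. Qed.

Lemma coact_etaR r : coact (etaR r) = 1 \ot (sR B r : H).
Proof.
rewrite -[etaR r]mul1r (comod_linear MP) coact1.
rewrite -[LHS]/(tact_right (@cright_act R CR) (1 \ot (1 : H) : tens raA _) r).
by rewrite tact_right_pure //= mul1r.
Qed.

Lemma counit_left_balanced : balanced (@cright_act R CR) (@cleft_act R CR)
  (fun h1 h2 => cleft_act (counit h1 : R) h2 : CR).
Proof.
case: CRP => -[[lD1 lD2 _ lA] _ _ _] _ eD _ er _ _.
split=> [h2 x y|h1 x y|h1 r h2] /=.
- by rewrite -[piR _ _]/(counit (x + y : CR)) eD; exact: lD2.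
- exact: lD1.
- by rewrite -[piR _ _]/(counit (@cright_act R CR h1 r)) er; exact: lA.
Qed.

(** The Takeuchi condition moves s_R r to t_R r on the other leg, where the
   counit law applies. *)
Lemma counit_sR_left r (h : H) :
  \tsum_(h1, h2 <- gammaR B h) cleft_act (counit (sR B r * h1 : CR)) (h2 : CR)
  = tR B r * h :> H.
Proof.
have bal := counit_left_balanced.
pose f := tlift (fun h1 h2 => cleft_act (counit h1 : R) h2 : CR)
  : tens (@cright_act R CR) (@cleft_act R CR) -> CR.
have fD : additive_map f by exact: tliftD.
have := congr1 f (gammaR_takeuchi B r h).
rewrite !(tlift_additive (g := f)) //.
rewrite (eq_tlift _ (G := fun h1 h2 => cleft_act (counit (sR B r * h1 : CR))
  (h2 : CR))); last by move=> x y; exact: tlift_pure.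
move=> ->; rewrite -[h in RHS](copr_counit_left CRP).
rewrite (tlift_additive (g := fun x : H => tR B r * x)); last first.
  exact: mulr_additive.
by apply: eq_tlift => x y; rewrite /f tlift_pure //= mulrA.
Qed.

(** The left R-action of the comodule A being given by etaR, the coaction takes
   its values in the Takeuchi product. *)
Lemma coact_takeuchi r a :
  tmap (fun x => etaR r * x) id (coact a)
  = tmap id (fun h : H => tR B r * h : H) (coact a) :> AH.
Proof.
pose f (h : CR) : R := counit (sR B r * h : CR).
have fP : functional (@cleft_act R CR) f.
  have [eD el] := counit_functional CRP.
  split=> [x y|s h]; rewrite /f; first by rewrite mulrDr; exact: eD.
  by rewrite -el /= mulrA.
have rA : is_rmodule raA by case: MP.
have fr : rlinear (tact_right (@cright_act R CR)) raA
    (tcontr f : tens raA (@cleft_act R CR) -> A).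
  split=> [|t s]; first exact: tcontr_additive.
  rewrite /tact_right (tcontr_tmap (la := @cleft_act R CR)) //; last first.
    exact: biaction_llinear.
  rewrite [RHS](tlift_additive (g := fun x => x * etaR s)); last first.
    exact: mull_additive.
  apply: eq_tlift => x h; rewrite -mulrA -etaRM /f.
  case: CRP => _ _ _ _ er _ _.
  by rewrite -er /= mulrA.
transitivity (tmap (fun x => tcontr f (coact x)) id (coact a) : AH).
  by apply: eq_tmap => // x; exact: coact_left_act.
transitivity (tmap (tcontr f) id (tmap coact id (coact a)
    : tens (tact_right (@cright_act R CR)) (@cleft_act R CR)) : AH).
  by rewrite tmap_comp.
rewrite [tmap coact _ _](comod_coassoc MP).
have cl := copr_llinear CRP.
have tl : llinear (@cleft_act R CR) (@cleft_act R CR) (fun h : H => tR B r * h : H).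
  by split=> [|s x] /=; [exact: mulr_additive | rewrite mulrA].
apply: (tens_ext (F := fun t => tmap (tcontr f) id (tcoact copr t))
  (G := fun t => tmap _ _ t)) (coact a) => [||m h].
- by apply: additive_comp; [exact: tcoact_additive | exact: tmap_additive].
- exact: tmap_additive.
rewrite tcoact_pure // tmap_comp // tmap_pure // -counit_sR_left.
rewrite [RHS](tlift_additive (g := tpure m)); last by move=> x y; exact: tpureDr.
by apply: eq_tlift => x y; rewrite tcontr_pure // tpureM.
Qed.

(** This is where the right A-action on A \ot_R H depends on the Takeuchi
   condition. *)
Lemma AH_right_balanced a' :
  balanced raA (@cleft_act R CR) (fun (a : A) (h : H) =>
    tmap (fun x => a * x) (fun x : H => h * x : H) (coact a') : AH).
Proof.
split=> [h a b|a h h'|a r h] /=.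
- by rewrite -tmap_addl; apply: eq_tmap => // x; rewrite mulrDl.
- by rewrite -tmap_addr; apply: eq_tmap => // x; rewrite mulrDl.
- transitivity (tmap (fun x => a * x) (fun x : H => h * x : H)
     (tmap (fun x => etaR r * x) id (coact a') : AH) : AH).
    rewrite tmap_comp; [|exact: rlinear_mul|exact: llinear_mul].
    by apply: eq_tmap => x //; rewrite mulrA.
  rewrite coact_takeuchi tmap_comp; [|exact: rlinear_mul|exact: llinear_mul].
  by apply: eq_tmap => x //; rewrite mulrA.
Qed.

Lemma AH_right_pure a (h : H) a' :
  AH_right (a \ot h : AH) a'
  = tmap (fun x => a * x) (fun x : H => h * x : H) (coact a').
Proof. exact: (tlift_pure _ _ (AH_right_balanced a')). Qed.

Lemma AH_right_additive a' : additive_map (fun t : AH => AH_right t a').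
Proof. exact: (tliftD (AH_right_balanced a')). Qed.

Lemma AH_right_additive_r (t : AH) : additive_map (AH_right t).
Proof.
move=> a b; rewrite -tlift_add; apply: eq_tlift => x h.
rewrite (comod_additive MP).
exact: (tmap_additive (rlinear_mul x) (llinear_mul h)).
Qed.

Lemma AH_leftE b (t : AH) : AH_left b t = tmap (fun a => b * a) id t.
Proof. by []. Qed.

Lemma AH_left_pure b a (h : H) : AH_left b (a \ot h : AH) = (b * a) \ot h.
Proof. by rewrite AH_leftE tmap_pure //; exact: rlinear_mul. Qed.

Lemma AH_left_additive b : additive_map (AH_left b : AH -> AH).
Proof. by apply: tmap_additive => //; exact: rlinear_mul. Qed.

Lemma AH_left_additive_l (t : AH) : additive_map (fun b => AH_left b t).
Proof.
move=> b b'; rewrite !AH_leftE -tmap_addl.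
by apply: eq_tmap => // x; rewrite mulrDl.
Qed.

Lemma coact_mul a a' : coact (a * a') = AH_right (coact a) a'.
Proof. exact: coactM. Qed.

(* Left multiplication by a \ot h in the algebra A \ot_k H, on A \ot_R H. *)
Lemma AH_right_tmap_mul a (h : H) (t : AH) b :
  AH_right (tmap (fun x => a * x) (fun x : H => h * x : H) t : AH) b
  = tmap (fun x => a * x) (fun x : H => h * x : H) (AH_right t b).
Proof.
have mD := tmap_additive (rlinear_mul a) (llinear_mul h).
apply: (tens_ext (F := fun t : AH => AH_right (tmap _ _ t) b)
                 (G := fun t : AH => tmap _ _ (AH_right t b))) t => [||x y].
- exact: (additive_comp mD (AH_right_additive b)).
- exact: (additive_comp (AH_right_additive b) mD).
rewrite tmap_pure; [|exact: rlinear_mul|exact: llinear_mul].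
rewrite !AH_right_pure tmap_comp; [|exact: rlinear_mul|exact: llinear_mul].
by apply: eq_tmap => z; rewrite mulrA.
Qed.

Lemma AH_rightM (t : AH) a b : AH_right t (a * b) = AH_right (AH_right t a) b.
Proof.
apply: (tens_ext (F := fun t : AH => AH_right t (a * b))
                 (G := fun t : AH => AH_right (AH_right t a) b)) t => [||x y].
- exact: AH_right_additive.
- exact: (additive_comp (AH_right_additive a) (AH_right_additive b)).
by rewrite !AH_right_pure AH_right_tmap_mul coact_mul.
Qed.

Lemma AH_leftM (t : AH) a b : AH_left (a * b) t = AH_left a (AH_left b t).
Proof.
rewrite !AH_leftE tmap_comp //; last exact: rlinear_mul.
by apply: eq_tmap => // x; rewrite mulrA.
Qed.

Lemma AH_left_right a (t : AH) b :
  AH_right (AH_left a t) b = AH_left a (AH_right t b).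
Proof.
apply: (tens_ext (F := fun t : AH => AH_right (AH_left a t) b)
                 (G := fun t : AH => AH_left a (AH_right t b))) t => [||x y].
- exact: (additive_comp (AH_left_additive a) (AH_right_additive b)).
- exact: (additive_comp (AH_right_additive b) (AH_left_additive a)).
rewrite AH_left_pure !AH_right_pure AH_leftE tmap_comp //;
  last exact: rlinear_mul.
by apply: eq_tmap => // z; rewrite mulrA.
Qed.

Lemma AH_biaction : biaction (@cleft_act A AC) (@cright_act A AC).
Proof.
split=> [a|b]; last exact: AH_right_additive.
by split=> [|t b]; [exact: AH_left_additive | rewrite /= AH_left_right].
Qed.

(** At a = 1: the coaction is b |-> (1 \ot 1) b, for the grouplike 1 \ot 1. *)
Lemma AH_right1 a b : AH_right (a \ot (1 : H) : AH) b = AH_left a (coact b).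
Proof. by rewrite AH_right_pure AH_leftE; apply: eq_tmap => // h; rewrite mul1r. Qed.

Lemma AH_left1 (t : AH) : AH_left 1 t = t.
Proof. by rewrite AH_leftE -[RHS]tmap_id; apply: eq_tmap => // x; rewrite mul1r. Qed.

Lemma AH_right_etaR (t : AH) r :
  AH_right t (etaR r) = tact_right (@cright_act R CR) t r.
Proof.
apply: (tens_ext (F := fun t : AH => AH_right t (etaR r))
                 (G := fun t : AH => tact_right _ t r)) t => [||x h].
- exact: AH_right_additive.
- exact: tact_right_additive.
rewrite AH_right_pure coact_etaR tact_right_pure // tmap_pure ?mulr1 //.
- exact: rlinear_mul.
- exact: llinear_mul.
Qed.

Lemma AH_etaR r (h : H) :
  (1 : A) \ot (h * tR B r : H) = AH_left (etaR r) (1 \ot h : AH).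
Proof.
rewrite AH_left_pure mulr1 -[X in X \ot h]mul1r.
exact: (esym (tpureM raA (@cleft_act R CR) 1 r h)).
Qed.

(** The map (A \ot_R H) \ot_R H -> (A \ot_R H) \ot_A (A \ot_R H), through which
   the coproduct of the associated coring factors. *)
Definition AH_to_tens (t : tens (tact_right (@cright_act R CR) : AH -> _)
    (@cleft_act R CR)) : tens (@cright_act A AC) (@cleft_act A AC) :=
  \tsum_(c, h <- t) ((c : AC) \ot ((1 : A) \ot (h : H) : AC)).

Lemma AH_to_tens_balanced : balanced
  (tact_right (@cright_act R CR) : AH -> _) (@cleft_act R CR)
  (fun c h => (c : AC) \ot ((1 : A) \ot (h : H) : AC)
              : tens (@cright_act A AC) (@cleft_act A AC)).
Proof.
split=> [h c d|c h h'|c r h] /=.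
- exact: tpureDl.
- by rewrite [in LHS]tpureDr; exact: tpureDr.
- rewrite -AH_right_etaR.
  rewrite [in RHS](AH_etaR r h); exact: (tpureM (@cright_act A AC)).
Qed.

Lemma AH_coprE (t : AH) : AH_copr t = AH_to_tens (tcoact (gammaR B) t).
Proof.
have bal := AH_to_tens_balanced.
rewrite [RHS](tlift_additive (g := AH_to_tens)); last exact: tliftD.
apply: eq_tlift => a h.
rewrite [RHS](tlift_additive (g := AH_to_tens)); last exact: tliftD.
apply: eq_tlift => h1 h2; symmetry; exact: tlift_pure.
Qed.

Lemma AH_copr_llinear :
  llinear (@cleft_act A AC) (tact_left cleft_act) (@copr A AC).
Proof.
have bal := AH_to_tens_balanced; have cl := copr_llinear CRP.
split=> [t u|b t] /=.
  by rewrite !AH_coprE (tcoact_additive bC cl); exact: (tliftD bal).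
rewrite !AH_coprE AH_leftE.
rewrite -(tcoact_natl bC cl t (rlinear_mul b)).
rewrite [LHS](tlift_additive (g := AH_to_tens)); last exact: tliftD.
rewrite [RHS](tlift_additive (g := tmap (AH_left b) id)); last first.
  exact: (tmap_additive (AH_biaction.1 b)).
apply: eq_tlift => c h; rewrite tmap_pure //; last exact: (AH_biaction.1 b).
exact: tlift_pure.
Qed.

(** Coassociativity of coact, the first leg of which is absorbed by
   coact a = (1 \ot 1) a. *)
Lemma AH_copr_coact a :
  AH_copr (coact a) = (1 \ot (1 : H) : AC) \ot (coact a : AC).
Proof.
have bal := AH_to_tens_balanced.
rewrite AH_coprE -[tcoact _ _](comod_coassoc MP).
rewrite [LHS](tlift_additive (g := AH_to_tens)); last exact: tliftD.
rewrite -[X in _ = _ \ot X]tlift_pureE.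
rewrite [RHS](tlift_additive (g := tpure _)); last by move=> x y; exact: tpureDr.
apply: eq_tlift => x h; rewrite /AH_to_tens tlift_pure //.
rewrite -[in RHS](mulr1 x) -AH_left_pure.
rewrite -[RHS](tpureM (@cright_act A AC)) /= AH_right1.
by rewrite AH_left1.
Qed.

Lemma AH_counit_functional : functional (@cleft_act A AC) (@counit A AC).
Proof.
have cf := counit_functional CRP; have rA : is_rmodule raA by case: MP.
split=> [|b t]; first exact: tcontr_additive.
rewrite -[LHS]/(tcontr counit (tmap _ id t)) -tcontr_nat //.
exact: rlinear_mul.
Qed.

Lemma mul_rmodule : is_rmodule (fun x y : A => x * y).
Proof.
split=> [a|a|a|x a b]; first exact: mull_additive; first exact: mulr_additive.
- exact: mulr1.
- exact: mulrA.
Qed.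

Lemma assoc_comodule : is_comodule (assoc_coact CA).
Proof.
have bA := AH_biaction; have cl := AH_copr_llinear.
have rr : rlinear (fun x y : A => x * y) (tact_right (@cright_act A AC))
    (assoc_coact CA).
  split=> [x y|x a]; rewrite /assoc_coact.
    by rewrite (comod_additive MP); exact: tpureDr.
  by rewrite coact_mul tact_right_pure.
split.
- exact: mul_rmodule.
- by case: rr.
- by case: rr.
- move=> a.
  rewrite -[LHS]/(tmap (assoc_coact CA) id (1 \ot (coact a : AC))).
  rewrite -[RHS]/(tcoact (@copr A AC) (1 \ot (coact a : AC))).
  rewrite tcoact_pure // tmap_pure //= AH_copr_coact tmap_pure //.
    by rewrite /assoc_coact coact1.
  exact: rlinear_tpure.
- move=> a; rewrite -[LHS]/(tcontr (@counit A AC) (1 \ot (coact a : AC))).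
  rewrite tcontr_pure ?mul1r //.
  + exact: (comod_counit MP).
  + exact: mul_rmodule.
  + exact: AH_counit_functional.
Qed.

End ComoduleAlgebra.

Section AssociatedExtension.
Variables (k : comPzRingType) (H L R : kalgebra k).
Variables (HH : hopf_algebroid H L R) (pureHH : pure_hopf_algebroid HH).
Variables (A : kalgebra k) (CA : comodule_algebra (HR HH) A).

Local Notation CL := (left_coring (HL HH)).
Local Notation CR := (right_coring (HR HH)).
Local Notation EL := (left_over_right HH).
Local Notation AC := (assoc_coring CA).
Local Notation EA := (left_over_assoc CA).
Local Notation coact := (coact CA).
Local Notation rhoA := (assoc_coact CA).
Local Notation raA := (fun (a : A) (r : R) => a * etaR CA r).

Let MP := coact_comodule CA.
Let CLP := left_coringP (HL HH).
Let CRP := right_coringP (HR HH).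
Let ELP := pureHH.1.1.
Let ELpure := pureHH.1.2.
Let bE := ext_biaction ELP.

Lemma assoc_ext_actE (t : AC) l : ext_act EA t l = tact_right (ext_act EL) t l.
Proof. by []. Qed.

Lemma assoc_ext_coactE (t : AC) :
  ext_coact EA t = tcoact (@ext_coact _ _ _ _ EL) t.
Proof. by []. Qed.

Lemma rlinear_AH_left b :
  rlinear (@ext_act _ _ _ _ EA) (@ext_act _ _ _ _ EA) (@cleft_act A AC b).
Proof. exact (tmap_rlinear bE (rlinear_mul CA b)). Qed.

Lemma assoc_ext_biaction : biaction (@cleft_act A AC) (@ext_act _ _ _ _ EA).
Proof.
split=> [b|l]; first exact: rlinear_AH_left.
exact (tact_right_additive (ra := raA) bE l).
Qed.

Lemma assoc_ext_coact_llinear :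
  llinear (@cleft_act A AC) (tact_left cleft_act) (@ext_coact _ _ _ _ EA).
Proof.
have cl := ext_coact_llinear ELP; split=> [|b t]; first exact (tcoact_additive bE cl).
exact (esym (tcoact_natl bE cl t (rlinear_mul CA b))).
Qed.

Lemma assoc_ind_act : ind_act EA rhoA = ind_act EL coact.
Proof.
apply/funext => a; apply/funext => l.
pose e (t : AC) : A := counit (ext_act EA t l).
have ecl : functional (@cleft_act R CR) (fun h => counit (ext_act EL h l)).
  exact: counit_ext_functional.
have eP : functional (@cleft_act A AC) e.
  have [eD el] := AH_counit_functional CA.
  split=> [t u|b t]; rewrite /e.
    by rewrite [ext_act _ _ _](tact_right_additive (ra := raA) bE); exact: eD.
  by rewrite -(rlinear_AH_left b).2 el.
rewrite -[LHS]/(tcontr e (1 \ot (coact a : AC))) tcontr_pure //; last first.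
  exact: mul_rmodule.
rewrite mul1r; apply: (tcontr_tmap (la := @cleft_act R CR) (ra := raA)
  (e := @counit R CR) (g := fun h => ext_act EL h l)).
- by case: MP.
- exact: counit_functional.
- exact: biaction_llinear.
Qed.

Let unit_tens (t : AC) : tens (fun x y : A => x * y) (@cleft_act A AC) := 1 \ot t.
Let tens_unit : tens (fun x y : A => x * y) (@cleft_act A AC) -> AC :=
  tlift (fun a t => AH_left a t).

Lemma tens_unit_balanced :
  balanced (fun x y : A => x * y) (@cleft_act A AC) (fun a t => AH_left a t).
Proof.
split=> [t a b|a t u|a b t] /=; last exact: AH_leftM.
- exact: AH_left_additive_l.
- exact: AH_left_additive.
Qed.

Lemma unit_tensK : cancel unit_tens tens_unit.
Proof.
move=> t; rewrite /tens_unit tlift_pure ?AH_left1 //.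
exact: tens_unit_balanced.
Qed.

Lemma unit_tens_rlinear :
  rlinear (@ext_act _ _ _ _ EA) (tact_right (@ext_act _ _ _ _ EA)) unit_tens.
Proof. exact/rlinear_tpure/assoc_ext_biaction. Qed.

Lemma tens_unit_rlinear :
  rlinear (tact_right (@ext_act _ _ _ _ EA)) (@ext_act _ _ _ _ EA) tens_unit.
Proof.
have bal := tens_unit_balanced; have bA := assoc_ext_biaction.
split=> [|u l]; first exact: tliftD.
apply: (tens_ext (F := fun u => tens_unit (tact_right _ u l))
                 (G := fun u => ext_act EA (tens_unit u) l)) u => [||a t].
- by apply: additive_comp; [exact: tact_right_additive | exact: tliftD].
- exact (additive_comp (tliftD bal) (bA.2 l)).
rewrite tact_right_pure // /tens_unit !tlift_pure //.
exact: (rlinear_AH_left a).2.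
Qed.

(** A \ot_A (A \ot_R H) being A \ot_R H, the coring extensions of A \ot_R H and
   of H induce the same left comodule A. *)
Lemma assoc_is_ind_coact a (t : tens (ind_act EA rhoA) (@cleft_act L CL)) :
  is_ind_coact a t <->
  tmap coact id t = tcoact (@ext_coact _ _ _ _ EL) (coact a)
  :> tens (tact_right (@ext_act _ _ _ _ EL)) (@cleft_act L CL).
Proof.
rewrite /is_ind_coact.
have -> : \tsum_(m0, m1 <- rhoA a)
      \tsum_(c, d <- ext_coact EA m1) (m0 \ot c \ot d)
   = tmap unit_tens id (ext_coact EA (coact a : AC))
   :> tens (tact_right (@ext_act _ _ _ _ EA)) (@cleft_act L CL).
  apply: (tcoact_pure (N := AC)); first exact: assoc_ext_biaction.
  exact: assoc_ext_coact_llinear.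
have -> : tmap rhoA id t = tmap unit_tens id
    (tmap coact id t : tens (@ext_act _ _ _ _ EA) (@cleft_act L CL))
   :> tens (tact_right (@ext_act _ _ _ _ EA)) (@cleft_act L CL).
  rewrite tmap_comp //; exact: unit_tens_rlinear.
split=> [|-> //]; apply: (can_inj (g := tmap tens_unit id)) => u.
rewrite tmap_comp //; last exact: tens_unit_rlinear.
by rewrite -[RHS]tmap_id; apply: eq_tmap => // x; exact: unit_tensK.
Qed.

(** Left colinearity for either extension amounts to [left_colinear], the
   uniqueness of the induced coaction being a consequence of purity. *)
Lemma colinear_assoc (p : H -> A) :
  colinear (@copr L CL) (ind_coact EA rhoA) p <->
  colinear (@copr R CR) coact p.
Proof.
have coactI := coaction_tensD_inj CRP CLP ELP ELpure MP.
have coactr := ind_act_rlinear CRP ELP MP.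
have coactE := is_ind_coact_exists CRP CLP ELP ELpure MP.
rewrite -assoc_ind_act in coactI coactr.
have ind_spec a : is_ind_coact a (ind_coact EA rhoA a).
  apply: ind_coact_spec; have := coactE a.
  rewrite /is_ind_coact -assoc_ind_act => -[t tE]; exists t.
  exact/assoc_is_ind_coact.
split=> [[pD pl pc]|/(colinear_left_colinear pureHH MP) [pD pl pc]].
  apply: (left_colinear_colinear pureHH MP); split=> // [l h|h].
    by rewrite -assoc_ind_act; exact: pl.
  have /assoc_is_ind_coact <- := ind_spec (p h).
  by rewrite pc tmap_comp.
split=> // [h l|h]; first by rewrite assoc_ind_act; exact: pl.
apply: coactI; have /assoc_is_ind_coact -> := ind_spec (p h).
by rewrite tmap_comp.
Qed.

End AssociatedExtension.

(** * Cleft extensions and cleft bicomodules *)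

Section Cleft.
Variables (k : comPzRingType) (H L R : kalgebra k).
Variables (HH : hopf_algebroid H L R) (pureHH : pure_hopf_algebroid HH).
Variables (A : kalgebra k) (CA : comodule_algebra (HR HH) A).

Local Notation CL := (left_coring (HL HH)).
Local Notation CR := (right_coring (HR HH)).
Local Notation EL := (left_over_right HH).
Local Notation ER := (right_over_left HH).
Local Notation AC := (assoc_coring CA).
Local Notation EA := (left_over_assoc CA).
Local Notation coact := (coact CA).
Local Notation rhoA := (assoc_coact CA).
Local Notation raA := (fun (a : A) (r : R) => a * etaR CA r).
Local Notation gL := (@copr L CL).
Local Notation gR := (@copr R CR).

Let MP := coact_comodule CA.
Let CLP := left_coringP (HL HH).
Let CRP := right_coringP (HR HH).
Let ELP := pureHH.1.1.
Let ERP := pureHH.2.1.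

Variable etaL : L -> A.
Hypothesis etaLP : algebra_map etaL.

Local Notation lA := (fun (l : L) (a : A) => etaL l * a).

Lemma etaL_D : additive_map etaL. Proof. by case: etaLP => -[]. Qed.
Lemma etaL_1 : etaL 1 = 1. Proof. by case: etaLP => _ []. Qed.
Lemma etaL_M l l' : etaL (l * l') = etaL l * etaL l'.
Proof. by case: etaLP => _ [_]; apply. Qed.

(** The condition at x = 1 is coinvariance of etaL l, and conversely coact is
   multiplicative. *)
Lemma left_linear_coinvariant :
  (forall l x, rhoA (etaL l * x) = tact_left lA l (rhoA x)) <->
  forall l, coinvariant CA (etaL l).
Proof.
split=> [ll l|co l x].
  have := congr1 (tlift (fun a t => AH_left a t)) (ll l 1).
  rewrite /tact_left /assoc_coact mulr1 tmap_pure //; last first.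
    by split=> [|x a]; [exact: mulr_additive | rewrite mulrA].
  rewrite !tlift_pure; try exact: tens_unit_balanced.
  by rewrite AH_left1 coact1 AH_left_pure !mulr1.
rewrite /tact_left /assoc_coact tmap_pure //; last first.
  by split=> [|y a]; [exact: mulr_additive | rewrite mulrA].
rewrite coact_mul co AH_right1 mulr1 -[X in X \ot coact x]mul1r.
exact: esym (tpureM _ _ _ _ _).
Qed.

Section Coinvariant.
Hypothesis etaL_coinv : forall l, coinvariant CA (etaL l).

Lemma coact_etaL l a : coact (etaL l * a) = AH_left (etaL l) (coact a).
Proof. by rewrite coact_mul etaL_coinv AH_right1. Qed.

Lemma coinvariant_bicomodule : is_bicomodule lA rhoA.
Proof.
split; last by apply/left_linear_coinvariant.
- split=> //; first 1 last.
  + exact: mul_rmodule.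
  + by move=> l x a; rewrite mulrA.
  + move=> c x; rewrite -kunit_central; congr (_ * _).
    by case: etaLP => -[_ /(_ c 1)] + [+ _]; rewrite !mulr1 => -> ->; rewrite mulr1.
  split=> [l|x|x|l l' x].
  + exact: mulr_additive.
  + by move=> l l'; rewrite etaL_D mulrDl.
  + by rewrite etaL_1 mul1r.
  + by rewrite etaL_M mulrA.
- exact: assoc_comodule.
Qed.

Section Pairings.
Variables (q : AC -> A -> A) (qP : in_Qtilde EA lA rhoA q).
Variables (p : CL -> A).
Hypothesis pD : additive_map p.
Hypothesis pl : forall l h, p (@cleft_act L CL l h) = etaL l * p h.

Lemma lozengeE d x : lozenge rhoA p q d x = q (coact (p d)) x.
Proof.
rewrite /lozenge /assoc_coact tlift_pure ?mul1r //.
case: qP => _ _ qD ql _ _; split=> [t a b|a t u|a b t] /=.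
- exact: mulrDl.
- by rewrite qD mulrDr.
- by rewrite ql mulrA.
Qed.

Lemma q_value c x : q c x = q c 1 * x.
Proof. by case: qP => _ <- _ _ _ _; rewrite mul1r. Qed.

Lemma bullet_balanced : balanced (@ext_act _ _ _ _ EA) (@cleft_act L CL)
  (fun c d => AH_left (q c 1) (coact (p d))).
Proof.
case: qP => _ _ qD _ qr _; split=> [d c c'|c d d'|c l d] /=.
- by rewrite qD AH_left_additive_l.
- by rewrite pD (comod_additive MP) AH_left_additive.
- by rewrite pl coact_etaL -AH_leftM -[tlift _ _]/(ext_act EA c l) qr q_value mulr1.
Qed.

(** As the coaction of A is 1 \ot coact, the inner Sweedler sum in the
   definition of q . p collapses. *)
Lemma bulletE c : bullet EA rhoA q p c
  = \tsum_(c0, d <- ext_coact EA c) AH_left (q c0 1) (coact (p d)).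
Proof.
apply: eq_tlift => c0 d; rewrite /assoc_coact tlift_pure ?mul1r //.
case: qP => qD _ _ _ _ _; split=> [t a b|a t u|a b t] /=.
- by rewrite qD AH_left_additive_l.
- exact: AH_left_additive.
- by rewrite -AH_leftM q_value mulrA -q_value.
Qed.

Lemma bullet_pure a (h : H) : bullet EA rhoA q p (a \ot h : AC)
  = \tsum_(h1, h2 <- gammaL (HL HH) h)
      AH_left (q (a \ot (h1 : H) : AC) 1) (coact (p h2)).
Proof.
rewrite bulletE assoc_ext_coactE tcoact_pure; first last.
- exact: ext_coact_llinear.
- exact: ext_biaction.
exact (tlift_tmap (tpure a) id (gL h) bullet_balanced).
Qed.

Lemma bullet_additive : additive_map (bullet EA rhoA q p).
Proof.
move=> c c'; rewrite !bulletE (assoc_ext_coact_llinear pureHH CA).1.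
exact: (tliftD bullet_balanced).
Qed.

End Pairings.

Section FromCleftExtension.
Variables (lam : CL -> A) (lamb : H -> A).
Hypothesis lam_left : forall l h, lam (@cleft_act L CL l h) = etaL l * lam h.
Hypothesis lam_colinear : colinear gR coact lam.
Hypothesis lamb_D : additive_map lamb.
Hypothesis lamb_tR : forall h r, lamb (h * tR (HR HH) r) = etaR CA r * lamb h.
Hypothesis lamb_tL : forall l h, lamb (tL (HL HH) l * h) = lamb h * etaL l.
Hypothesis lam_lamb : forall h,
  \tsum_(h1, h2 <- gammaR (HR HH) h) (lam h1 * lamb h2)
  = etaL (piL (HL HH) h).
Hypothesis lamb_lam : forall h,
  \tsum_(h1, h2 <- gammaL (HL HH) h) (lamb h1 * lam h2)
  = etaR CA (piR (HR HH) h).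

Let lam_D : additive_map lam. Proof. by case: lam_colinear. Qed.
Let lam_sR h r : lam (@cright_act R CR h r) = lam h * etaR CA r.
Proof. by case: lam_colinear. Qed.
Let coact_lam h : coact (lam h) = tmap lam id (gR h).
Proof. by case: lam_colinear. Qed.

Lemma lamb_coact_balanced :
  balanced (@ext_act _ _ _ _ EL) (@cleft_act L CL)
    (fun h1 h2 => AH_left (lamb h1) (coact (lam h2)) : AC).
Proof.
split=> [d c c'|c d d'|c l d] /=.
- by rewrite lamb_D AH_left_additive_l.
- by rewrite lam_D (comod_additive MP) AH_left_additive.
- by rewrite lam_left lamb_tL AH_leftM coact_etaL.
Qed.

(** This is jt . lam = id at 1 \ot h. Colinearity of lam and the mixed
   coassociativity law bring lamb and lam next to each other on the first leg of
   gammaR h, where they cancel; m is their product. *)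
Lemma lamb_coact_lam h :
  \tsum_(h1, h2 <- gammaL (HL HH) h) AH_left (lamb h1) (coact (lam h2))
  = (1 \ot h : AC).
Proof.
have bE := ext_biaction ERP; have gRl := ext_coact_llinear ERP.
pose m := tlift (fun h1 h2 => lamb h1 * lam h2)
  : tens (@ext_act _ _ _ _ EL) (@cleft_act L CL) -> A.
have mb : balanced (@ext_act _ _ _ _ EL) (@cleft_act L CL)
    (fun h1 h2 => lamb h1 * lam h2).
  split=> [d c c'|c d d'|c l d] /=; first by rewrite lamb_D mulrDl.
    by rewrite lam_D mulrDr.
  by rewrite lam_left lamb_tL mulrA.
have mr : rlinear (tact_right (@ext_act _ _ _ _ ER)) raA m.
  split=> [|t r]; first exact: tliftD.
  rewrite /m tlift_tmap // [RHS](tlift_additive (g := fun x => x * etaR CA r)).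
    by apply: eq_tlift => x y /=; rewrite -mulrA -lam_sR.
  exact: mull_additive.
have gLR : tmap gL id (gR h) = tcoact (la' := @cleft_act L CL) gR (gL h)
    :> tens (tact_right (@ext_act _ _ _ _ ER)) (@cleft_act R CR).
  exact: gammaL_gammaR.
transitivity (tmap m id (tcoact (la' := @cleft_act L CL) gR (gL h)
    : tens (tact_right (@ext_act _ _ _ _ ER)) (@cleft_act R CR)) : AC).
  rewrite [RHS](tlift_additive (g := tmap m id)); last exact: tmap_additive.
  apply: eq_tlift => h1 h2.
  rewrite [RHS](tlift_additive (g := tmap m id)); last exact: tmap_additive.
  rewrite coact_lam (tlift_additive (g := AH_left _)); last first.
    exact: AH_left_additive.
  by apply: eq_tlift => x y; rewrite AH_left_pure tmap_pure // /m tlift_pure.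
rewrite -gLR tmap_comp //.
rewrite -[h in RHS](copr_counit_left CRP).
rewrite [RHS](tlift_additive (g := tpure 1)); last by move=> x y; exact: tpureDr.
apply: eq_tlift => x y; rewrite [m _]lamb_lam -[X in X \ot _]mul1r.
exact: (tpureM raA).
Qed.

(** An antipode-free form of coact(lamb h) = lamb(h_(2)) \ot S(h_(1)). After
   expanding 1 \ot h^(1) by [lamb_coact_lam], the factors lam and lamb meet
   inside coact by multiplicativity, and their product is coinvariant. *)
Lemma AH_right_lamb h :
  \tsum_(h1, h2 <- gammaR (HR HH) h) AH_right (1 \ot (h1 : H) : AC) (lamb h2)
  = (lamb h \ot (1 : H) : AC).
Proof.
have bE := ext_biaction ERP; have gRl := ext_coact_llinear ERP.
have nb := lamb_coact_balanced.
pose n := tlift (fun h1 h2 => AH_left (lamb h1) (coact (lam h2)) : AC)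
  : tens (@ext_act _ _ _ _ EL) (@cleft_act L CL) -> AC.
have nr t r : n (tact_right (@ext_act _ _ _ _ ER) t r)
    = AH_right (n t) (etaR CA r).
  rewrite /n tlift_tmap // [RHS](tlift_additive (g := fun x => AH_right x _));
    last exact: AH_right_additive.
  apply: eq_tlift => x y /=; rewrite AH_left_right -coact_mul.
  by congr (AH_left _ (coact _)); exact: lam_sR.
have gLR : tmap gL id (gR h) = tcoact (la' := @cleft_act L CL) gR (gL h)
    :> tens (tact_right (@ext_act _ _ _ _ ER)) (@cleft_act R CR).
  exact: gammaL_gammaR.
(* n u and G (u \ot h) are 1 \ot h' and (1 \ot h') lamb h when u = gammaL h'. *)
pose G : tens (tact_right (@ext_act _ _ _ _ ER)) (@cleft_act R CR) -> AC :=
  tlift (fun u h2 => AH_right (n u) (lamb h2) : AC).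
have Gb : balanced (tact_right (@ext_act _ _ _ _ ER)) (@cleft_act R CR)
    (fun u h2 => AH_right (n u) (lamb h2) : AC).
  split=> [y u u'|u y y'|u r y].
  - by rewrite /n (tliftD nb) AH_right_additive.
  - by rewrite lamb_D AH_right_additive_r.
  - by rewrite nr -AH_rightM -lamb_tR.
transitivity (G (tmap gL id (gR h))).
  rewrite /G tlift_tmap //; apply: eq_tlift => x y; congr AH_right.
  exact: (esym (lamb_coact_lam x)).
rewrite gLR [LHS](tlift_additive (g := G)); last exact: tliftD.
transitivity (\tsum_(h1, h2 <- gL h)
   ((lamb (@ext_act _ _ _ _ EL h1 (counit (h2 : CL)))) \ot (1 : H)) : AC).
  apply: eq_tlift => h1 h2.
  rewrite [LHS](tlift_additive (g := G)); last exact: tliftD.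
  transitivity (AH_left (lamb h1) (coact (\tsum_(x, y <- gR h2) (lam x * lamb y)))).
    rewrite [RHS](tlift_additive (g := fun a => AH_left (lamb h1) (coact a)));
      last first.
      by move=> x y; rewrite (comod_additive MP) AH_left_additive.
    apply: eq_tlift => x y; rewrite /G tlift_pure // /n tlift_pure //.
    by rewrite AH_left_right coact_mul.
  rewrite lam_lamb etaL_coinv AH_left_pure /=.
  by rewrite -lamb_tL.
rewrite -[h in RHS](comod_counit (copr_comodule CLP)).
symmetry; apply: (tlift_additive (g := fun x => lamb x \ot (1 : H))) => x y.
by rewrite lamb_D tpureDl.
Qed.

Let ev (c : AC) : A := \tsum_(a, h <- c) (a * lamb h).

Lemma ev_balanced : balanced raA (@cleft_act R CR) (fun a h => a * lamb h).
Proof.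
split=> [h a b|a h h'|a r h] /=; first exact: mulrDl.
- by rewrite lamb_D mulrDr.
- by rewrite lamb_tR mulrA.
Qed.

Lemma ev_left b c : ev (AH_left b c) = b * ev c.
Proof.
rewrite /ev AH_leftE tlift_tmap; last exact: ev_balanced.
rewrite [RHS](tlift_additive (g := fun x => b * x)); last exact: mulr_additive.
by apply: eq_tlift => x y; rewrite mulrA.
Qed.

Lemma ev_right c l : ev (ext_act EA c l) = ev c * etaL l.
Proof.
rewrite /ev assoc_ext_actE tlift_tmap; last exact: ev_balanced.
rewrite [RHS](tlift_additive (g := fun x => x * etaL l)); last exact: mull_additive.
by apply: eq_tlift => x y; rewrite -mulrA -lamb_tL.
Qed.

(** Both sides of the compatibility with the coproduct equal ev c (1 \ot 1) x:
   the left one by [AH_right_lamb]. *)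
Lemma cleaving_dual_Qtilde : in_Qtilde EA lA rhoA (fun c x => ev c * x).
Proof.
have eb := ev_balanced; have eD : additive_map ev by exact: tliftD.
split=> [c|c x a|x c c'|a c x|c l x|x c].
- exact: mulr_additive.
- exact: mulrA.
- by rewrite /= eD mulrDl.
- by rewrite ev_left mulrA.
- by rewrite ev_right mulrA.
have Qb : balanced (@cright_act A AC) (@cleft_act A AC)
    (fun c1 c2 => AH_right c1 (ev c2 * x) : AC).
  split=> [d c1 c1'|c1 d d'|c1 a d] /=.
  - exact: AH_right_additive.
  - by rewrite eD mulrDl AH_right_additive_r.
  - by rewrite -AH_rightM ev_left mulrA.
have lD (b : AC) := AH_left_additive_l b.
transitivity (AH_left (ev c) (coact x)); last first.
  rewrite /assoc_coact tlift_pure ?mulr1 //.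
  split=> [t a b|a t u|a b t] /=; first by rewrite mulrDr lD.
    exact: AH_left_additive.
  by rewrite mulrA AH_leftM.
rewrite [LHS](tlift_additive (g := tlift _)); last exact: tliftD.
rewrite [RHS](tlift_additive (g := fun a => AH_left a (coact x))) //.
apply: eq_tlift => a h.
rewrite [LHS](tlift_additive (g := tlift _)); last exact: tliftD.
transitivity (AH_right (AH_left a (\tsum_(h1, h2 <- gammaR (HR HH) h)
    AH_right (1 \ot (h1 : H) : AC) (lamb h2))) x).
  rewrite [RHS](tlift_additive (g := fun t => AH_right (AH_left a t) x)).
    apply: eq_tlift => h1 h2; rewrite tlift_pure // /ev tlift_pure // mul1r.
    by rewrite -AH_left_right -AH_rightM AH_left_pure mulr1.
  move=> t u; rewrite AH_left_additive; exact: AH_right_additive.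
by rewrite AH_right_lamb AH_left_pure AH_right1.
Qed.

Lemma cleft_extension_cleft_bicomodule : cleft_bicomodule EA lA rhoA.
Proof.
have qP := cleaving_dual_Qtilde.
split; first exact: coinvariant_bicomodule.
exists lam, (fun c x => ev c * x); split=> //.
- split=> [//|]; exact/colinear_assoc.
- move=> c; apply: (tens_ext (Z := AH CA)
      (F := fun c : AH CA => bullet EA rhoA (fun c x => ev c * x) lam c)
      (G := fun c : AH CA => c)) c => // [|a h].
    exact (bullet_additive qP lam_D lam_left).
  apply: etrans (bullet_pure qP lam_D lam_left a h) _.
  transitivity (AH_left a (1 \ot h : AC)); last by rewrite AH_left_pure mulr1.
  rewrite -lamb_coact_lam [RHS](tlift_additive (g := AH_left a)); last first.
    exact: AH_left_additive.
  apply: eq_tlift => h1 h2; rewrite mulr1 /ev tlift_pure; last exact: ev_balanced.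
  by rewrite AH_leftM.
- move=> d x; rewrite lozengeE //; congr (_ * x).
  rewrite /ev coact_lam tlift_tmap; [exact: lam_lamb | exact: ev_balanced].
Qed.

End FromCleftExtension.

Section FromCleftBicomodule.
Variables (j : CL -> A) (jt : AC -> A -> A).
Hypothesis jP : is_left_linear_colinear EA lA rhoA j.
Hypothesis jtP : in_Qtilde EA lA rhoA jt.
Hypothesis bulletK : forall c, bullet EA rhoA jt j c = c.
Hypothesis lozengeK : forall d x, lozenge rhoA j jt d x = etaL (counit d) * x.

Let jb (h : H) : A := jt (1 \ot h : AC) 1.

(** The two cancellation laws are those of [bulletK] at 1 \ot h, after the counit
   of A \ot_R H, and of [lozengeK] at x = 1. *)
Lemma cleft_bicomodule_cleaving :
  [/\ (forall l h, j (sL (HL HH) l * h) = etaL l * j h)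
      /\ colinear gR coact j,
      [/\ additive_map jb,
          forall h r, jb (h * tR (HR HH) r) = etaR CA r * jb h
        & forall l h, jb (tL (HL HH) l * h) = jb h * etaL l],
      forall h, \tsum_(h1, h2 <- gammaR (HR HH) h) (j h1 * jb h2)
                = etaL (piL (HL HH) h)
    & forall h, \tsum_(h1, h2 <- gammaL (HL HH) h) (jb h1 * j h2)
                = etaR CA (piR (HR HH) h)].
Proof.
have [jl /(colinear_assoc pureHH) jc] := jP; have [jD _ cj] := jc.
have [_ _ qD ql qr _] := jtP.
split=> //.
- split=> [h h'|h r|l h]; rewrite /jb.
  + by rewrite [_ \ot _]tpureDr qD.
  + by rewrite AH_etaR ql.
  + have <- : ext_act EA (1 \ot h : AC) l = 1 \ot (tL (HL HH) l * h : H).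
      rewrite assoc_ext_actE; exact: (tact_right_pure _ (ext_biaction ELP)).
    by rewrite qr mulr1 (q_value jtP).
- move=> h; have := lozengeK h 1; rewrite (lozengeE jtP) mulr1 => <-.
  rewrite cj [RHS](tlift_additive (g := fun t : AC => jt t 1)); last first.
    exact: qD.
  apply: eq_tlift => x y; rewrite /jb -ql; congr (jt _ 1).
  by rewrite [LHS]AH_left_pure mulr1.
- move=> h; have := congr1 (@counit A AC) (bulletK (1 \ot h : AC)).
  have [eD el] := AH_counit_functional CA.
  rewrite bullet_pure // (tlift_additive (g := @counit A AC)) //.
  have -> : counit (1 \ot h : AC) = etaR CA (piR (HR HH) h).
    rewrite -[LHS]/(tcontr (@counit R CR) (1 \ot h)) tcontr_pure ?mul1r //.
      by case: MP.
    exact: counit_functional.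
  move <-; apply: eq_tlift => x y; rewrite el; congr (_ * _).
  exact: (esym (comod_counit MP _)).
Qed.

End FromCleftBicomodule.
End Coinvariant.
End Cleft.

Theorem proposition6p7 (k : comPzRingType) (H L R A : kalgebra k)
    (HH : hopf_algebroid H L R) (pureHH : pure_hopf_algebroid HH)
    (CA : comodule_algebra (HR HH) A) :
  cleft_extension CA <->
  exists etaL : L -> A,
    algebra_map etaL /\
    cleft_bicomodule (left_over_assoc CA)
      (fun (l : L) (a : A) => etaL l * a) (assoc_coact CA).
Proof.
split=> [[etaL [etaLP co [lam [lamb [[ll lc] [bD bR bL] e1 e2]]]]]|].
  exists etaL; split=> //.
  exact: (cleft_extension_cleft_bicomodule pureHH etaLP co ll lc bD bR bL e1 e2).
move=> [etaL [etaLP [[_ _ left] [j [jt [jP jtP bK lK]]]]]].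
have co : forall l, coinvariant CA (etaL l) by exact/left_linear_coinvariant.
exists etaL; split=> //; exists j, (fun h : H => jt (1 \ot h : AH CA) 1).
exact: cleft_bicomodule_cleaving.
Qed.
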